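(* Let $n\geq 2$ and let $K\subset\mathbb{C}^n$ be a convex body. Then $K$ is a (complex) ellipsoid if and only if any two non-trivial line sections of $K$ are affinely equivalent, i.e. whenever $L_1,L_2$ are complex affine lines such that $L_1\cap K$ and $L_2\cap K$ each contain more than one point, there is a complex affine bijection $\phi:L_1\to L_2$ with $\phi(L_1\cap K)=L_2\cap K$.
   Context: A convex body is a compact convex subset of $\mathbb{C}^n$ with nonempty interior. A (complex) ellipsoid in $\mathbb{C}^n$ is the image of the closed Euclidean unit ball under an invertible complex affine map. A line section of $K$ is $L\cap K$ for a complex affine line $L$; it is non-trivial if it is neither empty nor a single point. *)

(* Defs.v *)
(* C^n is modelled as row vectors
   'rV[R[i]]_n over the complex numbers R[i] (mathcomp-real-closed) of an
   arbitrary realType R.  The topology on R[i] is its norm (modulus)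
   topology, and 'rV[R[i]]_n carries the product topology, i.e. the usual
   Euclidean topology of C^n = R^(2n). *)
From HB Require Import structures.
From mathcomp Require Import all_boot all_order all_algebra.
From mathcomp Require Import all_classical all_reals all_analysis.
From mathcomp Require Import complex.

Set Implicit Arguments.
Unset Strict Implicit.
Unset Printing Implicit Defensive.

Import Order.TTheory GRing.Theory Num.Theory.

(* the (metric) topology of C = R[i] given by the complex modulus *)
HB.instance Definition _ (R : rcfType) := PseudoPointedMetric.copy R[i] (R[i])^o.

Local Open Scope ring_scope.
Local Open Scope classical_set_scope.

Definition Cn (R : realType) (n : nat) := 'rV[R[i]]_n.

Definition convex_set (R : realType) (n : nat) (K : set (Cn R n)) : Prop :=
  forall (x y : Cn R n) (t : R), K x -> K y -> 0 <= t <= 1 ->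
    K ((Complex t 0) *: x + (1 - Complex t 0) *: y).

Definition convex_body (R : realType) (n : nat) (K : set (Cn R n)) : Prop :=
  [/\ compact K, convex_set K & interior K !=set0].

Definition unit_ball (R : realType) (n : nat) : set (Cn R n) :=
  [set x | \sum_(i < n) `|x ord0 i| ^+ 2 <= 1].

Definition complex_ellipsoid (R : realType) (n : nat) (K : set (Cn R n)) : Prop :=
  exists (A : 'M[R[i]]_n) (b : Cn R n),
    A \in unitmx /\ K = [set x *m A + b | x in @unit_ball R n].

Definition affine_line (R : realType) (n : nat) (L : set (Cn R n)) : Prop :=
  exists (p v : Cn R n), v != 0 /\ L = [set p + z *: v | z in [set: R[i]]].

Definition nontrivial (T : Type) (S : set T) : Prop :=
  exists x y, S x /\ S y /\ x <> y.

Definition affine_bij_on (R : realType) (n : nat) (L1 L2 : set (Cn R n))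
    (phi : Cn R n -> Cn R n) : Prop :=
  [/\ (forall (x y : Cn R n) (s : R[i]), L1 x -> L1 y ->
          phi (s *: x + (1 - s) *: y) = s *: phi x + (1 - s) *: phi y),
      (forall x, L1 x -> L2 (phi x)),
      (forall x y, L1 x -> L1 y -> phi x = phi y -> x = y) &
      (forall y, L2 y -> exists2 x, L1 x & phi x = y)].

(* Main.v *)
Require Import Defs.
From HB Require Import structures.
From mathcomp Require Import all_boot all_order all_algebra.
From mathcomp Require Import all_classical all_reals all_analysis.
From mathcomp Require Import complex ring lra.

(* Proof. An affine map between complex lines is a similarity of the plane, so
   all sections through an interior point p0 are similar to one of them, S.
   The similarities of S onto the section in direction v have ratios a(v)
   forming a coset of the group G of rotation parts of self-similarities of S.
   If G is not the full circle it is contained in the k-th roots of unity for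
   some k > 0, and a(v)^k is a well-defined continuous nonvanishing function
   with a(u v)^k = u^-k a(v)^k; restricted to v = (b, 1 - |b|^2), |b| <= 1, it
   extends a nonzero multiple of u^-k from the circle to the disc, which is
   impossible. Hence G is the circle, S is a disc, and so are all sections.

   Now let x0 be the point of K farthest from the origin. Its tangent
   hyperplane {Re lam = 0} meets K only at x0. With x0 moved to the origin,
   every line through it transverse to the complex hyperplane {lam = 0} meets
   K in a disc {z | F(u) |z|^2 <= Re z}, lam u = 1. An inversion shows that,
   for F restricted to a complex line, every set {F <= affine} is a disc, a
   point or empty. This forces F to be a |Z|^2 + Re(b Z) + e there, hence K to
   be {Q <= Re lam} for a positive definite Hermitian form Q. *)

Set Implicit Arguments.
Unset Strict Implicit.
Unset Printing Implicit Defensive.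

Import Order.TTheory GRing.Theory Num.Theory.
Import numFieldNormedType.Exports.

Local Open Scope ring_scope.
Local Open Scope classical_set_scope.

Local Notation Re := complex.Re.
Local Notation Im := complex.Im.

(** * Squared norms *)

Section SquaredNorms.
Variable R : realType.
Implicit Types (z w : R[i]) (t : R).

(** Affine equivalence fixes the ratio a(v) only up to G and supplies no continuity in v: the power
    k removes the ambiguity, and compactness then gives continuity. Limits are taken along a free
    ultrafilter, so that all bounded sequences converge at once and no subsequences are extracted.

    Knowing that sections are discs leaves their centres and radii unrelated. The farthest point
    normalizes them: a disc in {Re z >= 0} that contains 0 is tangent to the imaginary axis, so a
    single number F(u) describes it. The substitution z = 1/W is the projective map sending {lam =
    0} to infinity. It turns the body into the region above the graph of F, just as it turns a ball
    into the region above a paraboloid, and sections by lines missing the origin become plane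
    sections of this graph. Identities along complex lines, without any continuity of F, then
    assemble the Hermitian form. *)

Definition normc2 z : R := Re z ^+ 2 + Im z ^+ 2.

Lemma complex_ext z w : Re z = Re w -> Im z = Im w -> z = w.
Proof. by case: z w => [a b] [c d] /= -> ->. Qed.
Lemma cReD z w : Re (z + w) = Re z + Re w. Proof. by case: z w => [a b] []. Qed.
Lemma cImD z w : Im (z + w) = Im z + Im w. Proof. by case: z w => [a b] []. Qed.
Lemma cReN z : Re (- z) = - Re z. Proof. by case: z. Qed.
Lemma cImN z : Im (- z) = - Im z. Proof. by case: z. Qed.
Lemma cReM z w : Re (z * w) = Re z * Re w - Im z * Im w.
Proof. by case: z w => [a b] []. Qed.
Lemma cImM z w : Im (z * w) = Re z * Im w + Im z * Re w.
Proof. by case: z w => [a b] []. Qed.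
Lemma cReJ z : Re (conjc z) = Re z. Proof. by case: z. Qed.
Lemma cImJ z : Im (conjc z) = - Im z. Proof. by case: z. Qed.
Lemma cReV z : Re z^-1 = Re z / normc2 z. Proof. by case: z. Qed.
Lemma cImV z : Im z^-1 = - (Im z / normc2 z). Proof. by case: z. Qed.
Lemma cRe1 : Re (1 : R[i]) = 1. Proof. by []. Qed.
Lemma cIm1 : Im (1 : R[i]) = 0. Proof. by []. Qed.
Lemma cRe0 : Re (0 : R[i]) = 0. Proof. by []. Qed.
Lemma cIm0 : Im (0 : R[i]) = 0. Proof. by []. Qed.

Definition cE := (cReD, cImD, cReN, cImN, cReM, cImM, cReJ, cImJ,
  cRe0, cIm0, cRe1, cIm1).

Lemma normc2_ge0 z : 0 <= normc2 z.
Proof. by rewrite addr_ge0 ?sqr_ge0. Qed.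

Lemma normc2_eq0 z : normc2 z = 0 -> z = 0.
Proof.
rewrite /normc2 => h; apply: complex_ext => /=; apply/eqP; rewrite -sqrf_eq0; apply/eqP.
  by have := sqr_ge0 (Re z); have := sqr_ge0 (Im z); lra.
by have := sqr_ge0 (Re z); have := sqr_ge0 (Im z); lra.
Qed.

Lemma normc2_gt0 z : z != 0 -> 0 < normc2 z.
Proof.
move=> z0; rewrite lt_neqAle normc2_ge0 andbT eq_sym.
by apply: contra z0 => /eqP/normc2_eq0->.
Qed.

Lemma normc2_0 : normc2 0 = 0. Proof. by rewrite /normc2 /= expr0n addr0. Qed.
Lemma normc2_1 : normc2 1 = 1.
Proof. by rewrite /normc2 /= expr0n expr1n addr0. Qed.
Lemma normc2N z : normc2 (- z) = normc2 z.
Proof. by rewrite /normc2 !cE; ring. Qed.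
Lemma normc2M z w : normc2 (z * w) = normc2 z * normc2 w.
Proof. by rewrite /normc2 !cE; ring. Qed.
Lemma normc2C t : normc2 t%:C%C = t ^+ 2.
Proof. by rewrite /normc2 /= expr0n addr0. Qed.
Lemma normc2X z k : normc2 (z ^+ k) = normc2 z ^+ k.
Proof. by elim: k => [|k IH]; rewrite ?expr0 ?normc2_1 // !exprS normc2M IH. Qed.
Lemma normc2V z : normc2 z^-1 = (normc2 z)^-1.
Proof.
have [->|z0] := eqVneq z 0; first by rewrite invr0 normc2_0 invr0.
apply: (mulfI (lt0r_neq0 (normc2_gt0 z0))).
by rewrite -normc2M !divff ?normc2_1 // lt0r_neq0 // normc2_gt0.
Qed.
Lemma normc2D z w : normc2 (z + w) = normc2 z + normc2 w + 2 * Re (z * conjc w).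
Proof. by rewrite /normc2 !cE; ring. Qed.
(** The two sides differ by the squared modulus of [z - w]; this replaces the triangle inequality
    and avoids square roots. *)
Lemma normc2D_le z w : normc2 (z + w) <= 2 * normc2 z + 2 * normc2 w.
Proof.
rewrite /normc2 !cE.
by have := sqr_ge0 (Re z - Re w); have := sqr_ge0 (Im z - Im w); lra.
Qed.
Lemma normc2B_le z w : normc2 (z - w) <= 2 * normc2 z + 2 * normc2 w.
Proof. by rewrite -(normc2N w) normc2D_le. Qed.
Lemma mul_conjc z : z * conjc z = (normc2 z)%:C%C.
Proof. by apply: complex_ext; rewrite !cE /normc2 /=; ring. Qed.

(** The norm of [R[i]] takes values in [R[i]]; this is the passage to the real-valued [normc2]. *)
Lemma sqr_norm z : `|z| ^+ 2 = (normc2 z)%:C%C.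
Proof.
case: z => a b; rewrite /normc2 /=.
rewrite -[`|_|]/((Num.sqrt (a ^+ 2 + b ^+ 2))%:C%C) -rmorphXn /=.
by rewrite sqr_sqrtr // addr_ge0 ?sqr_ge0.
Qed.

Section Vectors.
Variable n : nat.
Implicit Types (x y : Cn R n).

Definition normv2 x : R := \sum_(i < n) normc2 (x ord0 i).

Lemma normv2_ge0 x : 0 <= normv2 x.
Proof. by apply: sumr_ge0 => i _; exact: normc2_ge0. Qed.
Lemma normv2_coord x i : normc2 (x ord0 i) <= normv2 x.
Proof.
by rewrite /normv2 (bigD1 i) //= lerDl sumr_ge0 // => j _; exact: normc2_ge0.
Qed.
Lemma normv2_eq0 x : normv2 x = 0 -> x = 0.
Proof.
move=> x0; apply/rowP => i; rewrite mxE; apply: normc2_eq0; apply/eqP.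
by rewrite eq_le normc2_ge0 andbT -x0 normv2_coord.
Qed.
Lemma normv2_gt0 x : x != 0 -> 0 < normv2 x.
Proof.
move=> x0; rewrite lt_neqAle normv2_ge0 andbT eq_sym.
by apply: contra x0 => /eqP/normv2_eq0->.
Qed.
Lemma normv2_0 : normv2 0 = 0.
Proof. by rewrite /normv2 big1 // => i _; rewrite mxE normc2_0. Qed.
Lemma normv2N x : normv2 (- x) = normv2 x.
Proof. by apply: eq_bigr => i _; rewrite mxE normc2N. Qed.
Lemma normv2Z z x : normv2 (z *: x) = normc2 z * normv2 x.
Proof. by rewrite /normv2 mulr_sumr; apply: eq_bigr => i _; rewrite mxE normc2M. Qed.
Lemma normv2D_le x y : normv2 (x + y) <= 2 * normv2 x + 2 * normv2 y.
Proof.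
rewrite /normv2 !mulr_sumr -big_split /=; apply: ler_sum => i _.
by rewrite mxE normc2D_le.
Qed.
End Vectors.
End SquaredNorms.

(** * Limits along a free ultrafilter *)

Lemma free_ultrafilter_exists :
  exists U : set_system nat, UltraFilter U /\ (\oo : set_system nat) `<=` U.
Proof. exact: ultraFilterLemma. Qed.

(** It refines the filter of cofinite sets, so ordinary limits persist, while every bounded sequence
    acquires a limit. *)
Definition ultraN : set_system nat := projT1 (cid free_ultrafilter_exists).

Instance ultraN_ultra : UltraFilter ultraN.
Proof. by case: (projT2 (cid free_ultrafilter_exists)). Qed.

Lemma ultraN_oo : (\oo : set_system nat) `<=` ultraN.
Proof. by case: (projT2 (cid free_ultrafilter_exists)). Qed.

Lemma ultraNT (P : nat -> Prop) : (forall n, P n) -> ultraN [set n | P n].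
Proof. by move=> h; apply: filterS filterT => n _; exact: h. Qed.

Lemma ultraN_ge N : ultraN [set n | (N <= n)%N].
Proof. by apply: ultraN_oo; exists N. Qed.

Lemma ultraN2 (P Q : nat -> Prop) : ultraN [set n | P n] ->
  ultraN [set n | Q n] -> exists n, P n /\ Q n.
Proof. by move=> hP hQ; have := filter_ex (filterI hP hQ) => -[n [? ?]]; exists n. Qed.

(** For an ultrafilter a cluster point is a limit: if it missed the preimage of a neighbourhood it
    would contain the complement, against clustering. *)
Lemma compact_ultraN (T : topologicalType) (A : set T) (u : nat -> T) :
  compact A -> (forall n, A (u n)) -> exists p, A p /\ u @ ultraN --> p.
Proof.
move=> Aco Au.
have [|p [Ap clp]] := Aco (u @ ultraN) _; first exact: ultraNT.
exists p; split=> // B Bp.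
have [//|FnB] := in_ultra_setVsetC (u @^-1` B) ultraN_ultra.
by have [q [nBq Bq]] := clp _ _ (FnB : (u @ ultraN) (~` B)) Bp.
Qed.

Section UltraLimits.
Variable R : realType.
Implicit Types (a : nat -> R) (u v : nat -> R[i]) (l m z : R[i]) (M : R).

Lemma rlim_exists a M : (forall n, `|a n| <= M) -> exists l : R, a @ ultraN --> l.
Proof.
move=> aM; have [|l [_ hl]] := compact_ultraN (u := a) (@segment_compact R (- M) M).
  by move=> n /=; rewrite in_itv /= -ler_norml.
by exists l.
Qed.

Lemma rlim_le a (l M : R) : a @ ultraN --> l -> (forall n, a n <= M) -> l <= M.
Proof. by move=> al aM; apply: (cvgr_to_le al); exact: ultraNT. Qed.

Lemma rlim_ge a (l M : R) : a @ ultraN --> l -> (forall n, M <= a n) -> M <= l.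
Proof. by move=> al aM; apply: (cvgr_to_ge al); exact: ultraNT. Qed.

Lemma rlim_unique a (l m : R) : a @ ultraN --> l -> a @ ultraN --> m -> l = m.
Proof. by move=> al am; rewrite -(cvg_lim _ al) // -(cvg_lim _ am). Qed.

Lemma rlim_lt a (l M : R) : a @ ultraN --> l -> l < M -> ultraN [set n | a n < M].
Proof. by move=> al Ml; exact: (cvgr_lt l). Qed.

Lemma rlim_harmonic : (fun n => (n.+1%:R)^-1 : R) @ ultraN --> (0 : R).
Proof. by move=> B B0; apply: ultraN_oo; exact: (@cvg_harmonic R _ B0). Qed.

(** Stated on real and imaginary parts so that the limit rules for real sequences apply directly. *)
Definition ulim u l := (fun n => Re (u n)) @ ultraN --> Re l /\
  (fun n => Im (u n)) @ ultraN --> Im l.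

Lemma ulim_cst z : ulim (fun=> z) z.
Proof. by split; exact: cvg_cst. Qed.

Lemma ulimD u v l m : ulim u l -> ulim v m -> ulim (fun n => u n + v n) (l + m).
Proof.
move=> [ul ul'] [vm vm']; split.
  have -> : (fun n => Re (u n + v n)) = (fun n => Re (u n)) + (fun n => Re (v n)).
    by apply/funext => n; rewrite /= cReD.
  by rewrite cReD; exact: cvgD.
have -> : (fun n => Im (u n + v n)) = (fun n => Im (u n)) + (fun n => Im (v n)).
  by apply/funext => n; rewrite /= cImD.
by rewrite cImD; exact: cvgD.
Qed.

Lemma ulimM u v l m : ulim u l -> ulim v m -> ulim (fun n => u n * v n) (l * m).
Proof.
move=> [ul ul'] [vm vm']; split.
  have -> : (fun n => Re (u n * v n)) =
            (fun n => Re (u n)) * (fun n => Re (v n)) -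
            (fun n => Im (u n)) * (fun n => Im (v n)).
    by apply/funext => n; rewrite /= cReM.
  by rewrite cReM; apply: cvgB; exact: cvgM.
have -> : (fun n => Im (u n * v n)) =
          (fun n => Re (u n)) * (fun n => Im (v n)) + (fun n => Im (u n)) * (fun n => Re (v n)).
  by apply/funext => n; rewrite /= cImM.
by rewrite cImM; apply: cvgD; exact: cvgM.
Qed.

Lemma ulimN u l : ulim u l -> ulim (fun n => - u n) (- l).
Proof.
by move=> ul; have := ulimM (ulim_cst (-1)) ul; rewrite mulN1r;
  under eq_fun do rewrite mulN1r.
Qed.

Lemma ulimB u v l m : ulim u l -> ulim v m -> ulim (fun n => u n - v n) (l - m).
Proof. by move=> ul vm; exact: (ulimD ul (ulimN vm)). Qed.

Lemma ulimX u l k : ulim u l -> ulim (fun n => u n ^+ k) (l ^+ k).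
Proof.
move=> ul; elim: k => [|k IH]; first exact: ulim_cst.
by rewrite exprS; under eq_fun do rewrite exprS; exact: ulimM.
Qed.

Lemma ulimC a (l : R) : a @ ultraN --> l -> ulim (fun n => (a n)%:C%C) l%:C%C.
Proof. by move=> al; split=> //=; exact: cvg_cst. Qed.

Lemma ulim_normc2 u l : ulim u l -> (fun n => normc2 (u n)) @ ultraN --> normc2 l.
Proof.
move=> [ul ul'].
have -> : (fun n => normc2 (u n)) =
          (fun n => Re (u n)) * (fun n => Re (u n)) + (fun n => Im (u n)) * (fun n => Im (u n)).
  by apply/funext => n; rewrite /normc2 !expr2.
by rewrite /normc2 !expr2; apply: cvgD; exact: cvgM.
Qed.

Lemma ulim_near u l (e : R) : ulim u l -> 0 < e ->
  ultraN [set n | normc2 (u n - l) < e].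
Proof.
move=> ul e0; have := ulim_normc2 (ulimB ul (ulim_cst l)).
by rewrite subrr normc2_0 => /rlim_lt; exact.
Qed.

Lemma ulim_unique u l m : ulim u l -> ulim u m -> l = m.
Proof.
by move=> [ul ul'] [um um']; apply: complex_ext;
  [exact: rlim_unique ul um|exact: rlim_unique ul' um'].
Qed.

Lemma norm_Re_le z M : 0 <= M -> normc2 z <= M ^+ 2 -> `|Re z| <= M.
Proof.
move=> M0 zM; rewrite -(ler_pXn2r (n := 2)) ?nnegrE // real_normK ?num_real //.
by apply: le_trans zM; rewrite lerDl sqr_ge0.
Qed.

Lemma norm_Im_le z M : 0 <= M -> normc2 z <= M ^+ 2 -> `|Im z| <= M.
Proof.
move=> M0 zM; rewrite -(ler_pXn2r (n := 2)) ?nnegrE // real_normK ?num_real //.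
by apply: le_trans zM; rewrite lerDr sqr_ge0.
Qed.

Lemma ulim_exists u M : (forall n, normc2 (u n) <= M) -> exists l, ulim u l.
Proof.
move=> uM; have M0 : 0 <= M by apply: le_trans (uM 0); exact: normc2_ge0.
have uM' n : normc2 (u n) <= Num.sqrt M ^+ 2 by rewrite sqr_sqrtr.
have [x hx] := @rlim_exists (fun n => Re (u n)) (Num.sqrt M)
  (fun n => norm_Re_le (sqrtr_ge0 _) (uM' n)).
have [y hy] := @rlim_exists (fun n => Im (u n)) (Num.sqrt M)
  (fun n => norm_Im_le (sqrtr_ge0 _) (uM' n)).
by exists (Complex x y).
Qed.

Section Vectors.
Variable n : nat.
Implicit Types (x y : nat -> Cn R n) (p q : Cn R n).

Definition vlim x p := forall i, ulim (fun k => x k ord0 i) (p ord0 i).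

Lemma vlim_cst p : vlim (fun=> p) p.
Proof. by move=> i; exact: ulim_cst. Qed.

Lemma vlimD x y p q : vlim x p -> vlim y q -> vlim (fun k => x k + y k) (p + q).
Proof.
by move=> xp yq i; rewrite mxE; under eq_fun do rewrite mxE; exact: ulimD.
Qed.

Lemma vlimZ u x l p : ulim u l -> vlim x p -> vlim (fun k => u k *: x k) (l *: p).
Proof.
by move=> ul xp i; rewrite mxE; under eq_fun do rewrite mxE; exact: ulimM.
Qed.

Lemma vlimB x y p q : vlim x p -> vlim y q -> vlim (fun k => x k - y k) (p - q).
Proof.
move=> xp yq i; rewrite !mxE; under eq_fun do rewrite !mxE.
exact: ulimB.
Qed.

Lemma vlim_unique x p q : vlim x p -> vlim x q -> p = q.
Proof. by move=> xp xq; apply/rowP => i; exact: ulim_unique (xp i) (xq i). Qed.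

Lemma vlim_normv2 x p : vlim x p -> (fun k => normv2 (x k)) @ ultraN --> normv2 p.
Proof.
move=> xp; rewrite /normv2; apply: cvg_big => //; first exact: add_continuous.
by move=> i _; exact: ulim_normc2.
Qed.

Lemma vlim_near x p (e : R) : vlim x p -> 0 < e ->
  ultraN [set k | normv2 (x k - p) < e].
Proof.
move=> xp e0; have := vlim_normv2 (vlimB xp (vlim_cst p)).
by rewrite subrr normv2_0 => /rlim_lt; exact.
Qed.
End Vectors.
End UltraLimits.

(** A maximizing sequence, whose limit attains the supremum on a compact set. It yields the radius
    of a rotation-invariant section and the farthest point of the body. *)
Lemma sup_approx (R : realType) (T : Type) (A : set T) (f : T -> R) (M : R) :
  A !=set0 -> (forall x, A x -> f x <= M) ->
  exists s : R, exists u : nat -> T, (forall x, A x -> f x <= s) /\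
    (forall n, A (u n)) /\ (f \o u) @ ultraN --> s.
Proof.
move=> [x0 Ax0] fM; pose s := sup (f @` A).
have hs : has_sup (f @` A).
  by split; [exists (f x0), x0|exists M => _ [x Ax <-]; exact: fM].
have fs x : A x -> f x <= s by move=> Ax; apply: sup_upper_bound => //; exists x.
have ex n : exists x, A x /\ s - n.+1%:R^-1 < f x.
  have [_ [x Ax <-] hx] := sup_adherent (ltac:(by rewrite invr_gt0) : 0 < (n.+1%:R : R)^-1) hs.
  by exists x.
pose u n := projT1 (cid (ex n)).
have hu n : A (u n) /\ s - n.+1%:R^-1 < f (u n) := projT2 (cid (ex n)).
exists s, u; split=> //; split=> [n|]; first exact: (hu n).1.
have hl : (fun n => s - (n.+1%:R)^-1 : R) @ ultraN --> s.
  by rewrite -[in X in _ --> X](subr0 s); apply: cvgB; [exact: cvg_cst|exact: rlim_harmonic].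
apply: (squeeze_cvgr _ hl (cvg_cst s)); apply: ultraNT => n /=.
by rewrite (ltW (hu n).2) fs //; exact: (hu n).1.
Qed.

Lemma norm_lt_normc2 (R : realType) (z : R[i]) (e : R) :
  `|z| < e%:C%C -> normc2 z < e ^+ 2.
Proof.
move=> ze; rewrite -ltcR -sqr_norm rmorphXn /= ltr_pXn2r // nnegrE.
exact: le_trans (normr_ge0 z) (ltW ze).
Qed.

Lemma normc2_lt_norm (R : realType) (z : R[i]) (e : R) : 0 <= e ->
  normc2 z < e ^+ 2 -> `|z| < e%:C%C.
Proof.
by move=> e0; rewrite -ltcR -sqr_norm rmorphXn /= ltr_pXn2r // nnegrE lecR.
Qed.

(** * Compactness and interior in terms of squared norms *)

Section ConvexBodies.
Variables (R : realType) (n : nat).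
Implicit Types (K : set (Cn R n)).

Lemma cvg_vlim (u : nat -> Cn R n) (p : Cn R n) : u @ ultraN --> p -> vlim u p.
Proof.
move=> up i.
suff H (e : R) : 0 < e -> ultraN [set k | normc2 (u k ord0 i - p ord0 i) < e ^+ 2].
  split; apply/cvgrPdist_lt => e e0; apply: filterS (H e e0) => k /= hk.
    rewrite -cReN -cReD -(ltr_pXn2r (n := 2)) ?nnegrE ?normr_ge0 ?(ltW e0) //.
    rewrite real_normK ?num_real //; apply: le_lt_trans hk.
    by rewrite -(opprB (p _ _)) normc2N lerDl sqr_ge0.
  rewrite -cImN -cImD -(ltr_pXn2r (n := 2)) ?nnegrE ?normr_ge0 ?(ltW e0) //.
  rewrite real_normK ?num_real //; apply: le_lt_trans hk.
  by rewrite -(opprB (p _ _)) normc2N lerDr sqr_ge0.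
move=> e0.
have e0' : 0 < (e%:C%C : R[i]) by rewrite ltcR.
have hb : ultraN (u @^-1` @ball R[i] 'rV[R[i]]_n p e%:C%C).
  exact: up _ (@nbhsx_ballx R[i] 'rV[R[i]]_n p e%:C%C e0').
apply: filterS hb => k hk.
have [_ /(_ ord0 i) hk'] : @mx_ball _ _ _ _ p e%:C%C (u k) := hk.
have {}hk' : `|p ord0 i - u k ord0 i| < e%:C%C := hk'.
by rewrite /= -normc2N opprB; exact: norm_lt_normc2.
Qed.

Lemma compact_vlim K (u : nat -> Cn R n) : compact K -> (forall k, K (u k)) ->
  exists l, K l /\ vlim u l.
Proof.
by move=> Kc uK; have [p [Kp up]] := compact_ultraN Kc uK; exists p; split=> //;
  exact: cvg_vlim.
Qed.

Lemma interior_ball K : interior K !=set0 ->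
  exists p (r : R), 0 < r /\ forall x, normv2 (x - p) < r -> K x.
Proof.
move=> [p hp].
have /nbhs_ballP [e e0 hK] : @nbhs _ 'rV[R[i]]_n p K := hp.
(* A positive element of [R[i]] is real, so the radius can be read in R. *)
have [e1 e2] : Im e = 0 /\ 0 < Re e.
  by move: e0; rewrite /= ltcE /= => /andP[/eqP -> ->].
exists p, (Re e ^+ 2); split; first by rewrite exprn_gt0.
move=> x hx; apply: hK.
have -> : e = (Re e)%:C%C by apply: complex_ext => //=.
suff : @mx_ball _ _ _ _ p (Re e)%:C%C x by [].
split; first by rewrite ltcR.
move=> i j; rewrite (ord1 i).
suff : `|p ord0 j - x ord0 j| < (Re e)%:C%C by [].
apply: normc2_lt_norm; first exact: ltW.
apply: le_lt_trans hx.
by rewrite -normc2N opprB; have := normv2_coord (x - p) j; rewrite !mxE.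
Qed.
End ConvexBodies.

(** * The topological obstruction *)

Section Winding.
Variable R : realType.
Implicit Types (t s : R) (z : R[i]).

Definition cis t : R[i] := Complex (cos t) (sin t).

Lemma cisD s t : cis (s + t) = cis s * cis t.
Proof. by apply: complex_ext; rewrite !cE /= ?cosD ?sinD; ring. Qed.
Lemma cis0 : cis 0 = 1. Proof. by rewrite /cis cos0 sin0. Qed.
Lemma normc2_cis t : normc2 (cis t) = 1.
Proof. by rewrite /normc2 /= cos2Dsin2. Qed.
Lemma cisX k t : cis t ^+ k = cis (t *+ k).
Proof.
elim: k => [|k IH]; first by rewrite expr0 mulr0n cis0.
by rewrite exprS IH -cisD mulrS.
Qed.
Lemma cis_pi : cis pi = -1.
Proof. by apply: complex_ext; rewrite !cE /= ?cospi ?sinpi ?oppr0. Qed.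

(** In the right half-plane [atan] gives a continuous branch of the argument. *)
Lemma polar_atan z : 0 < Re z ->
  exists2 r : R, 0 < r & z = r%:C%C * cis (atan (Im z / Re z)).
Proof.
move=> z0; set a := atan _.
have ca : 0 < cos a by rewrite cos_gt0_pihalf // atan_gtNpi2 atan_ltpi2.
have ta : sin a = cos a * (Im z / Re z).
  by rewrite -(atanK (Im z / Re z)) -/a /tan mulrC divfK // gt_eqF.
exists (Re z / cos a); first by rewrite divr_gt0.
apply: complex_ext; rewrite !cE /= ?ta mul0r ?subr0 ?addr0.
  by rewrite divfK // gt_eqF.
by field; rewrite !gt_eqF.
Qed.

Lemma continuous_sum (N : nat) (f : nat -> R -> R) :
  (forall j, (j < N)%N -> continuous (f j)) ->
  continuous (fun t => \sum_(j < N) f j t).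
Proof.
elim: N => [|N IH] fc.
  by under eq_fun do rewrite big_ord0; move=> t; exact: cvg_cst.
under eq_fun do rewrite big_ord_recr /=.
move=> t; apply: continuousD; last exact: fc.
by apply: IH => j jN; apply: fc; exact: ltnW.
Qed.

(** [S] is a continuous argument of h(cis t) / h(0), summed along the radius from 0 to cis t.
    Uniform continuity allows the same finite number of steps for all t. The sum depends on t only
    through cis t, so it is unchanged by a full turn: the winding number is zero. *)
Lemma circle_lift (h : R[i] -> R[i]) (m : R) : 0 < m ->
  (forall b, normc2 b <= 1 -> m <= normc2 (h b)) ->
  (forall e : R, 0 < e -> exists2 d : R, 0 < d & forall b b', normc2 b <= 1 ->
     normc2 b' <= 1 -> normc2 (b - b') < d -> normc2 (h b - h b') < e) ->
  exists S : R -> R, [/\ continuous S, S (pi *+ 2) = S 0 &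
    forall t, exists2 r : R, 0 < r & h (cis t) = r%:C%C * (h 0 * cis (S t))].
Proof.
move=> m0 hm hc.
have [d d0 hd] := hc m m0.
have [N hN] : exists N : nat, (N.+1%:R^-1 : R) ^+ 2 < d.
  exists (Num.bound (d^-1)).
  have dN : d^-1 < (Num.bound d^-1).+1%:R.
    apply: lt_le_trans (_ : (Num.bound d^-1)%:R <= _); last by rewrite ler_nat.
    by have := archi_boundP (ltW (ltac:(by rewrite invr_gt0) : 0 < d^-1)).
  rewrite exprVn -[ltRHS]invrK ltf_pV2 ?posrE ?exprn_gt0 ?invr_gt0 //.
  apply: lt_le_trans dN _; rewrite expr2 ler_peMr // ler1n //.
pose s (j : nat) : R := j%:R / N.+1%:R.
have s01 j : (j <= N.+1)%N -> 0 <= s j <= 1.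
  by move=> jN; rewrite divr_ge0 //= ler_pdivrMr // mul1r ler_nat.
pose P (j : nat) t := h ((s j)%:C%C * cis t).
have nb j t : (j <= N.+1)%N -> normc2 ((s j)%:C%C * cis t) <= 1.
  move=> /s01/andP[s0 s1]; rewrite normc2M normc2_cis mulr1 normc2C.
  by rewrite expr_le1.
have Pm j t : (j <= N.+1)%N -> m <= normc2 (P j t) by move=> jN; apply/hm/nb.
(* Both values have squared modulus at least [m] and their difference less than [m], so their ratio
   has positive real part. *)
have PP j t : (j < N.+1)%N -> 0 < Re (P j.+1 t * conjc (P j t)).
  move=> jN; have := hd _ _ (nb j.+1 t jN) (nb j t (ltnW jN)).
  rewrite -mulrBl normc2M normc2_cis mulr1 -rmorphB normc2C.
  have -> : s j.+1 - s j = N.+1%:R^-1 by rewrite /s -mulrBl -natrB // subSnn mul1r.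
  move=> /(_ hN); rewrite -/(P _ _) -/(P j t).
  rewrite normc2D normc2N => h1.
  have := Pm j.+1 t jN; have := Pm j t (ltnW jN).
  move: h1; rewrite !cE; lra.
pose A j t := let q := P j.+1 t * conjc (P j t) in atan (Im q / Re q).
have cisc t e : 0 < e -> \forall x \near t, normc2 (cis x - cis t) < e.
  move=> e0.
  have H : (fun x => normc2 (cis x - cis t)) x @[x --> t] --> (0 : R).
    have -> : 0 = (cos t - cos t) * (cos t - cos t) + (sin t - sin t) * (sin t - sin t).
      by rewrite !subrr !mul0r addr0.
    have -> : (fun x => normc2 (cis x - cis t)) =
       (fun x => (cos x - cos t) * (cos x - cos t) + (sin x - sin t) * (sin x - sin t)).
      by apply/funext => x; rewrite /normc2 !cE /= !expr2.
    have c1 : (cos x - cos t) @[x --> t] --> cos t - cos t.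
      by apply: cvgB; [exact: continuous_cos|exact: cvg_cst].
    have s1 : (sin x - sin t) @[x --> t] --> sin t - sin t.
      by apply: cvgB; [exact: continuous_sin|exact: cvg_cst].
    by apply: cvgD; exact: cvgM.
  exact: (cvgr_lt 0 H).
have Pc j t e : (j <= N.+1)%N -> 0 < e -> \forall x \near t, normc2 (P j t - P j x) < e ^+ 2.
  move=> jN e0; have [d' d'0 hd'] := hc (e ^+ 2) ltac:(by rewrite exprn_gt0).
  apply: filterS (cisc t d' d'0) => x hx.
  apply: hd'; [exact: nb|exact: nb|].
  rewrite -mulrBr normc2M normc2C; apply: le_lt_trans hx.
  rewrite -(normc2N (cis x - _)) opprB ler_piMl ?normc2_ge0 //.
  by have /andP[s0 s1] := s01 j jN; rewrite expr_le1.
have RePc j : (j <= N.+1)%N -> continuous (fun t => Re (P j t)).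
  move=> jN t; apply/cvgrPdist_lt => e e0; apply: filterS (Pc j t e jN e0) => x hx.
  rewrite -cReN -cReD -(ltr_pXn2r (n := 2)) ?nnegrE ?normr_ge0 ?(ltW e0) //.
  by rewrite real_normK ?num_real //; apply: le_lt_trans hx; rewrite lerDl sqr_ge0.
have ImPc j : (j <= N.+1)%N -> continuous (fun t => Im (P j t)).
  move=> jN t; apply/cvgrPdist_lt => e e0; apply: filterS (Pc j t e jN e0) => x hx.
  rewrite -cImN -cImD -(ltr_pXn2r (n := 2)) ?nnegrE ?normr_ge0 ?(ltW e0) //.
  by rewrite real_normK ?num_real //; apply: le_lt_trans hx; rewrite lerDr sqr_ge0.
have Ac j : (j < N.+1)%N -> continuous (A j).
  move=> jN t; rewrite /A.
  apply: continuous_comp; last exact: continuous_atan.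
  have -> : (fun t => Im (P j.+1 t * conjc (P j t)) / Re (P j.+1 t * conjc (P j t))) =
    (fun t => (Re (P j.+1 t) * (- Im (P j t)) + Im (P j.+1 t) * Re (P j t)) /
             (Re (P j.+1 t) * Re (P j t) - Im (P j.+1 t) * (- Im (P j t)))).
    by apply/funext => x; rewrite !cE.
  have c1 := RePc _ jN t; have c2 := ImPc _ jN t.
  have c3 := RePc _ (ltnW jN) t; have c4 := ImPc _ (ltnW jN) t.
  apply: cvgM; first by apply: cvgD; apply: cvgM => //; exact: cvgN.
  apply: cvgV; first by have := PP j t jN; rewrite !cE => /lt0r_neq0.
  by apply: cvgB; apply: cvgM => //; exact: cvgN.
exists (fun t => \sum_(j < N.+1) A j t); split.
- exact: continuous_sum.
- apply: eq_bigr => j _; rewrite /A /P.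
  have -> : cis (pi *+ 2) = cis 0; last by [].
  by rewrite cis0 /cis cos2pi sin2pi.
move=> t.
have L j : (j <= N.+1)%N ->
    exists2 r : R, 0 < r & P j t = r%:C%C * (h 0 * cis (\sum_(i < j) A i t)).
  elim: j => [_|j IH jN].
    exists 1 => //; rewrite big_ord0 cis0 mul1r mulr1 /P /s mul0r.
    by rewrite rmorph0 mul0r.
  have [r r0 Pr] := IH (ltnW jN).
  have [r' r'0 Pr'] := polar_atan (PP j t jN).
  have P0 : 0 < normc2 (P j t) by apply: lt_le_trans m0 (Pm _ _ (ltnW jN)).
  exists (r' * r / normc2 (P j t)); first by rewrite divr_gt0 ?mulr_gt0.
  apply: (mulIf (_ : (normc2 (P j t))%:C%C != 0)).
    by apply/eqP => /(congr1 (@complex.Re _)) /= /eqP; rewrite gt_eqF.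
  rewrite {1}(_ : (normc2 (P j t))%:C%C = conjc (P j t) * P j t); last first.
    by rewrite mulrC mul_conjc.
  rewrite [LHS]mulrA Pr' -/(A j t) big_ord_recr /= cisD.
  set a := cis (\sum_(i < j) A i t); set b := cis (A j t).
  set nu := normc2 (P j t) in P0 *; rewrite Pr -/a; set w := h 0.
  have -> : (r' * r / nu)%:C%C = r'%:C%C * r%:C%C * nu%:C%C^-1.
    by rewrite -rmorphM /= -fmorphV -rmorphM.
  have nu0 : nu%:C%C != 0 :> R[i].
    by apply/eqP => /(congr1 (@complex.Re _)) /= /eqP; rewrite gt_eqF.
  by field.
have [r r0] := L _ (leqnn _); rewrite /P /s divff ?pnatr_eq0 // rmorph1 mul1r => ->.
by exists r.
Qed.

(** On the circle the argument of h(u) = c u^-k would turn k times backwards, while the lift returns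
    to its initial value. *)
Lemma no_disc_extension (h : R[i] -> R[i]) (k : nat) (m : R) (c : R[i]) :
  (0 < k)%N -> 0 < m ->
  (forall b, normc2 b <= 1 -> m <= normc2 (h b)) ->
  (forall e : R, 0 < e -> exists2 d : R, 0 < d & forall b b', normc2 b <= 1 ->
     normc2 b' <= 1 -> normc2 (b - b') < d -> normc2 (h b - h b') < e) ->
  (forall u, normc2 u = 1 -> u ^+ k * h u = c) -> False.
Proof.
move=> k0 m0 hm hc hk.
have [S [Sc S2 hS]] := circle_lift m0 hm hc.
pose F t := S t + t *+ k.
have Fc : continuous F.
  move=> t; apply: cvgD; first exact: Sc.
  exact: cvgMn.
have F2 : F (pi *+ 2) = F 0 + pi *+ (2 * k).
  by rewrite /F S2 mul0rn addr0 -mulrnA.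
have pi0 := @pi_gt0 R.
(* [F] is an argument of c / h(0) at every t; shifted by pi it makes c a negative multiple of
   itself. *)
have [t _ Ft] : exists2 t, t \in `[0, pi *+ 2]%R & F t = F 0 + pi.
  apply: (@IVT R F 0 (pi *+ 2) (F 0 + pi));
    [by rewrite mulrn_wge0 // ltW|exact: continuous_subspaceT|].
  have h1 : F 0 <= F (pi *+ 2) by rewrite F2 lerDl mulrn_wge0 // ltW.
  rewrite (min_idPl h1) (max_idPr h1) lerDl (ltW pi0) F2 lerD2l /=.
  by rewrite -{1}(mulr1n pi) ler_wpMn2l ?(ltW pi0) // muln_gt0.
have hF x : exists2 r : R, 0 < r & c = r%:C%C * (h 0 * cis (F x)).
  have [r r0 hr] := hS x; exists r => //.
  by rewrite -(hk (cis x) (normc2_cis x)) hr cisX /F cisD; ring.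
have [r r0 hr] := hF 0; have [r' r'0 hr'] := hF t.
move: hr'; rewrite Ft cisD cis_pi hr => /eqP; rewrite -subr_eq0.
have -> : r%:C%C * (h 0 * cis (F 0)) - r'%:C%C * (h 0 * (cis (F 0) * -1)) =
          (r + r')%:C%C * (h 0 * cis (F 0)) by rewrite rmorphD /=; ring.
move=> /eqP/(congr1 (@normc2 R)); rewrite !normc2M normc2_cis normc2C normc2_0 mulr1.
have h0 : 0 < normc2 (h 0) by apply: (lt_le_trans m0); apply: hm; rewrite normc2_0.
by move=> /eqP; rewrite mulf_eq0 (gt_eqF h0) orbF gt_eqF // exprn_gt0 // addr_gt0.
Qed.
End Winding.

(** * Sections through an interior point *)

Section Angles.
Variable R : realType.
Implicit Types (u : R[i]).

Lemma cis_arg u : normc2 u = 1 -> 0 <= Im u ->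
  exists2 t : R, 0 <= t <= pi & u = cis t.
Proof.
rewrite /normc2 => u1 iu.
have hu : -1 <= Re u <= 1 by have := sqr_ge0 (Im u); nra.
exists (acos (Re u)); first by rewrite acos_ge0 ?acos_lepi.
apply: complex_ext => /=; first by rewrite acosK.
rewrite sin_acos //; have -> : 1 - Re u ^+ 2 = Im u ^+ 2 by lra.
by rewrite sqrtr_sqr ger0_norm.
Qed.

Lemma ulim_cis (a : nat -> R) (t : R) : a @ ultraN --> t -> ulim (fun k => cis (a k)) (cis t).
Proof.
move=> at'; split => /=.
  exact: (continuous_cvg _ (@continuous_cos R t) at').
exact: (continuous_cvg _ (@continuous_sin R t) at').
Qed.

Lemma normc2_1_inv u : normc2 u = 1 -> u^-1 = conjc u.
Proof.
by move=> u1; apply: complex_ext; rewrite ?cReV ?cImV ?cReJ ?cImJ u1 divr1.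
Qed.

Lemma expr_bounded_le1 (x B : R) : (forall k, x ^+ k <= B) -> x <= 1.
Proof.
move=> h; rewrite leNgt; apply/negP => x1.
have ber k : 1 + k%:R * (x - 1) <= x ^+ k.
  elim: k => [|k IH]; first by rewrite mul0r addr0 expr0.
  rewrite exprS -natr1; have : 0 <= k%:R * (x - 1) by rewrite mulr_ge0 // subr_ge0 ltW.
  by move: IH; nra.
have x10 : 0 < x - 1 by rewrite subr_gt0.
have B0 : 0 <= B / (x - 1) by rewrite divr_ge0 ?ltW //; apply: lt_le_trans (h 0%N);
  rewrite expr0.
have := archi_boundP B0; set k := Num.bound _; rewrite ltr_pdivrMr // => hk.
by have := ber k; have := h k; lra.
Qed.

End Angles.

Section SectionsThroughInteriorPoint.
Variables (R : realType) (n : nat) (K : set (Cn R n)) (p0 e1 e2 : Cn R n) (r0 M : R).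
Hypothesis Kcvx : Defs.convex_set K.
Hypothesis Kcmp : forall u : nat -> Cn R n, (forall k, K (u k)) -> exists l, K l /\ vlim u l.
Hypothesis r0_gt0 : 0 < r0.
Hypothesis Kball : forall x, normv2 (x - p0) < r0 -> K x.
Hypothesis KM : forall x, K x -> normv2 (x - p0) <= M.
Hypothesis e12 : forall a b : R[i], normv2 (a *: e1 + b *: e2) = normc2 a + normc2 b.
Implicit Types (v : Cn R n) (a c z y : R[i]).

Definition lsec v z := K (p0 + z *: v).
(** All sections are compared with the one in direction [e1]; [a] is the ratio a(v). *)
Definition lsim v a c := a != 0 /\ forall z, lsec e1 z <-> lsec v (a * z + c).
(** Keeps v bounded and away from 0, for estimates uniform in v. It covers [e1] and the disc of
    directions used later, whose squared norms lie in [3/4, 1]. *)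
Definition lgood v := 2^-1 <= normv2 v <= 2.

Lemma normv2_e1 : normv2 e1 = 1.
Proof. by have := e12 1 0; rewrite scale1r scale0r addr0 normc2_1 normc2_0 addr0. Qed.

Lemma good_e1 : lgood e1.
Proof. by rewrite /lgood normv2_e1; lra. Qed.

Lemma lsec_in v y : normc2 y * normv2 v < r0 -> lsec v y.
Proof. by move=> h; apply: Kball; rewrite addrC addKr normv2Z. Qed.

Lemma lsec_le v y : lsec v y -> normc2 y * normv2 v <= M.
Proof. by move=> /KM; rewrite addrC addKr normv2Z. Qed.

Lemma lsec_good_le v y : lgood v -> lsec v y -> normc2 y <= 2 * M.
Proof.
move=> /andP[g1 g2] /lsec_le; have := normc2_ge0 y; nra.
Qed.

(** A common point of all sections in [lgood] directions, as r0/4 times 2 is below r0. Together with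
    0 it measures the ratio of a similarity. *)
Let s : R := Num.sqrt r0 / 2.
Let ss : normc2 s%:C%C = r0 / 4.
Proof. by rewrite normc2C /s expr_div_n sqr_sqrtr ?(ltW r0_gt0) //; field. Qed.

Lemma lsec_s v : lgood v -> lsec v s%:C%C.
Proof. by move=> /andP[g1 g2]; apply: lsec_in; rewrite ss; have := r0_gt0; nra. Qed.

Lemma lsec_0 v : lsec v 0.
Proof. by apply: lsec_in; rewrite normc2_0 mul0r. Qed.

Lemma M_gt0 : 0 < M.
Proof.
have := lsec_le (lsec_s good_e1); rewrite ss normv2_e1; have := r0_gt0; lra.
Qed.

Lemma lsim_c_le v a c : lgood v -> lsim v a c -> normc2 c <= 2 * M.
Proof.
move=> gv [_ h]; apply: (lsec_good_le gv); have := (h 0).1 (lsec_0 _).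
by rewrite mulr0 add0r.
Qed.

(** The points 0 and s go to c and a s + c, both of squared modulus at most 2 M, so |a|^2 r0/4 <= 8
    M. *)
Lemma lsim_a_le v a c : lgood v -> lsim v a c -> normc2 a <= 32 * M / r0.
Proof.
move=> gv sim; have h1 := lsim_c_le gv sim.
have h2 := lsec_good_le gv ((sim.2 _).1 (lsec_s good_e1)).
have := normc2B_le (a * s%:C%C + c) c; rewrite addrK normc2M ss => h3.
by rewrite ler_pdivlMr //; lra.
Qed.

(** The preimages of 0 and s differ by s / a and have squared modulus at most 2 M. *)
Lemma lsim_a_ge v a c : lgood v -> lsim v a c -> r0 / (32 * M) <= normc2 a.
Proof.
move=> gv [a0 sim]; have M0 := M_gt0.
have h1 : lsec e1 (- c / a).
  by apply/sim; have -> : a * (- c / a) + c = 0; [by field|exact: lsec_0].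
have h2 : lsec e1 ((s%:C%C - c) / a).
  by apply/sim; have -> : a * ((s%:C%C - c) / a) + c = s%:C%C; [by field|exact: lsec_s].
have := lsec_good_le good_e1 h1; have := lsec_good_le good_e1 h2 => {}h2 {}h1.
have := normc2B_le ((s%:C%C - c) / a) (- c / a) => h3.
have : normc2 a * normc2 ((s%:C%C - c) / a - - c / a) = r0 / 4.
  by rewrite -normc2M -ss; congr normc2; field.
rewrite ler_pdivrMr; last by lra.
by have := normc2_ge0 a; nra.
Qed.

Lemma lsec_closed (vv : nat -> Cn R n) (y : nat -> R[i]) v y' :
  vlim vv v -> ulim y y' -> (forall k, lsec (vv k) (y k)) -> lsec v y'.
Proof.
move=> hv hy hK; have [l [Kl hl]] := Kcmp hK.
have := vlimD (vlim_cst p0) (vlimZ hy hv).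
by move=> /(vlim_unique hl) E; rewrite /lsec -E.
Qed.

(** Closedness of K gives one inclusion. For the other, a point y of the limit section is contracted
    to t y with t < 1; this point is interior, so nearby points of the approximating sections lie in
    K and can be pulled back. Then t tends to 1. *)
Lemma lsim_closed (vv : nat -> Cn R n) (a c : nat -> R[i]) v a' c' :
  (forall k, lgood (vv k)) -> (forall k, lsim (vv k) (a k) (c k)) ->
  vlim vv v -> ulim a a' -> ulim c c' -> lsim v a' c'.
Proof.
move=> gv sim hv ha hc.
have M0 := M_gt0.
have a'0 : a' != 0.
  have := rlim_ge (ulim_normc2 ha) (fun k => lsim_a_ge (gv k) (sim k)).
  by apply: contraTneq => ->; rewrite normc2_0 -ltNge divr_gt0 // mulr_gt0.
split=> // z; split=> [Sz|].
  apply: (lsec_closed hv (ulimD (ulimM ha (ulim_cst z)) hc)) => k.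
  by have := ((sim k).2 z).1 Sz.
set y := a' * z + c' => Ky.
pose zt (t : R) := (t%:C%C * y - c') / a'.
have Szt t : 0 <= t < 1 -> lsec e1 (zt t).
  move=> /andP[t0 t1].
  pose x k := p0 + (a k * zt t + c k) *: vv k.
  have xm : vlim x (p0 + (t%:C%C * y) *: v).
    have -> : t%:C%C * y = a' * zt t + c' by rewrite /zt; field.
    exact: vlimD (vlim_cst p0) (vlimZ (ulimD (ulimM ha (ulim_cst _)) hc) hv).
  have e0 : 0 < r0 * (1 - t) ^+ 2 by rewrite mulr_gt0 // exprn_gt0 // subr_gt0.
  have [k hk] := filter_ex (vlim_near xm e0).
  apply/(sim k).2; rewrite /lsec -/(x k).
  set m := _ + _ in hk.
  have t1' : (1 - t)%:C%C != 0 :> R[i].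
    by apply/eqP => /(congr1 (@complex.Re _)) /= /eqP; rewrite gt_eqF // subr_gt0.
  (* A convex combination of the given point of K and a point of the ball around [p0]. *)
  have -> : x k = (Complex t 0) *: (p0 + y *: v) +
         (1 - Complex t 0) *: (p0 + (1 - t)%:C%C^-1 *: (x k - m)).
    move: (x k) => X.
    have E : 1 - Complex t 0 = (1 - t)%:C%C :> R[i].
      by apply: complex_ext; rewrite !cE //= subr0.
    rewrite E !(scalerDr, scalerA) divff // scale1r /m addrACA -scalerDl.
    have -> : Complex t 0 + (1 - t)%:C%C = 1 :> R[i] by rewrite -E addrC subrK.
    by rewrite !scale1r addrA [RHS]addrC subrK.
  apply: (Kcvx Ky); last by rewrite t0 ltW.
  apply: Kball; rewrite [_ - p0]addrC addKr normv2Z normc2V normc2C.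
  by rewrite mulrC ltr_pdivrMr // exprn_gt0 // subr_gt0.
have ht : (fun k => 1 - k.+1%:R^-1 : R) @ ultraN --> (1 : R).
  by rewrite -[in X in _ --> X](subr0 (1:R)); apply: cvgB;
    [exact: cvg_cst|exact: rlim_harmonic].
have hz : ulim (fun k => zt (1 - k.+1%:R^-1)) (zt 1).
  apply: ulimM; last exact: ulim_cst.
  apply: ulimB; last exact: ulim_cst.
  by apply: ulimM; [exact: ulimC|exact: ulim_cst].
have -> : z = zt 1 by rewrite /zt rmorph1 mul1r /y addrK mulrC mulKf.
apply: (lsec_closed (vlim_cst e1) hz) => k; apply: Szt.
rewrite subr_ge0 invf_le1 // ler1n /= ltrBlDr ltrDl invr_gt0 ltr0n //.
Qed.

(** The group G, with the modulus of its elements left free; [selfsim_unit] shows that it is 1. *)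
Definition selfsim g := exists c, lsim e1 g c.

(** The first similarity followed by the inverse of the second: the ratios for one direction form a
    coset of G. *)
Lemma lsim_div v a c a' c' : lsim v a c -> lsim v a' c' -> selfsim (a / a').
Proof.
move=> [a0 h] [a'0 h']; exists ((c - c') / a'); split; first by rewrite mulf_neq0 ?invr_eq0.
move=> z; have -> : a / a' * z + (c - c') / a' = (a * z + c - c') / a' by field.
rewrite h h'; have -> // : a' * ((a * z + c - c') / a') + c' = a * z + c by field.
Qed.

Lemma lsim_scale v a c u : u != 0 -> lsim (u *: v) a c -> lsim v (u * a) (u * c).
Proof.
move=> u0 [a0 h]; split; first by rewrite mulf_neq0.
move=> z; rewrite h /lsec scalerA.
by have -> : (a * z + c) * u = u * a * z + u * c by ring.
Qed.

Lemma selfsim_neq0 g : selfsim g -> g != 0. Proof. by case=> c []. Qed.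

Lemma selfsim1 : selfsim 1.
Proof. by exists 0; split; [exact: oner_neq0|move=> z; rewrite mul1r addr0]. Qed.

Lemma selfsim_div g g' : selfsim g -> selfsim g' -> selfsim (g / g').
Proof. by move=> [c h] [c' h']; exact: lsim_div h h'. Qed.

Lemma selfsimV g : selfsim g -> selfsim g^-1.
Proof. by move=> /(selfsim_div selfsim1); rewrite mul1r. Qed.

Lemma selfsimM g g' : selfsim g -> selfsim g' -> selfsim (g * g').
Proof. by move=> h /selfsimV h'; have := selfsim_div h h'; rewrite invrK. Qed.

Lemma selfsimX g k : selfsim g -> selfsim (g ^+ k).
Proof. by move=> h; elim: k => [|k IH]; rewrite ?exprS; [exact: selfsim1|exact: selfsimM]. Qed.

Lemma selfsim_le g : selfsim g -> normc2 g <= 32 * M / r0.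
Proof. by move=> [c h]; exact: lsim_a_le good_e1 h. Qed.

(** All powers of g and of its inverse obey one bound, so neither has modulus above 1. *)
Lemma selfsim_unit g : selfsim g -> normc2 g = 1.
Proof.
have L h : selfsim h -> normc2 h <= 1.
  move=> hh; apply: (@expr_bounded_le1 _ _ (32 * M / r0)) => k.
  by rewrite -normc2X selfsim_le //; exact: selfsimX.
move=> hg; apply/eqP; rewrite eq_le L //=.
have := L _ (selfsimV hg); rewrite normc2V invf_le1 // normc2_gt0 //; exact: selfsim_neq0.
Qed.

Lemma selfsim_closed (g : nat -> R[i]) g' :
  (forall k, selfsim (g k)) -> ulim g g' -> selfsim g'.
Proof.
move=> hg gg'; pose c k := projT1 (cid (hg k)).
have hc k : lsim e1 (g k) (c k) := projT2 (cid (hg k)).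
have [c' hc'] := ulim_exists (fun k => lsim_c_le good_e1 (hc k)).
by exists c'; exact: lsim_closed (fun=> good_e1) hc (vlim_cst e1) gg' hc'.
Qed.

(** Elements near 1 have angles tending to 0; suitable multiples of these tend to any prescribed
    angle, and G is closed. *)
Lemma selfsim_dense :
  (forall e : R, 0 < e -> exists g, [/\ selfsim g, g <> 1 & normc2 (g - 1) < e]) ->
  forall u, normc2 u = 1 -> selfsim u.
Proof.
move=> acc.
have acc' (k : nat) : exists t : R, [/\ 0 < t <= pi, selfsim (cis t) &
  normc2 (cis t - 1) < k.+1%:R^-1].
  have [g [hg g1 ge]] := acc (k.+1%:R^-1) ltac:(by rewrite invr_gt0 ltr0n).
  have ng := selfsim_unit hg.
  (* Inverting if necessary moves g to the upper half-plane, so that its angle lies between 0 and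
     pi. *)
  have [g' [hg' g'1 g'e ig']] : exists g',
      [/\ selfsim g', g' <> 1, normc2 (g' - 1) < k.+1%:R^-1 & 0 <= Im g'].
    have [ig|ig] := leP 0 (Im g); first by exists g.
    exists g^-1; split.
    - exact: selfsimV.
    - by move=> /(congr1 GRing.inv); rewrite invrK invr1.
    - apply: le_lt_trans ge; rewrite normc2_1_inv // le_eqVlt; apply/orP; left.
      by apply/eqP; rewrite /normc2 !cE; ring.
    - by rewrite normc2_1_inv // cImJ oppr_ge0 ltW.
  have [t /andP[t0 tpi] E] := cis_arg (selfsim_unit hg') ig'.
  exists t; rewrite -E; split=> //; rewrite tpi andbT lt_neqAle t0 andbT.
  by apply/eqP => t00; apply: g'1; rewrite E -t00 cis0.
pose th k := projT1 (cid (acc' k)).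
have hth k : [/\ 0 < th k <= pi, selfsim (cis (th k)) & normc2 (cis (th k) - 1) < k.+1%:R^-1] :=
  projT2 (cid (acc' k)).
have [t ht] : exists t : R, th @ ultraN --> t.
  apply: (@rlim_exists _ _ pi) => k; have [/andP[h1 h2] _ _] := hth k.
  by rewrite ger0_norm // ltW.
have t0 : t = 0.
  have ct : cis t = 1.
    apply/eqP; rewrite -subr_eq0; apply/eqP/normc2_eq0/eqP; rewrite eq_le normc2_ge0 andbT.
    have l1 := ulim_normc2 (ulimB (ulim_cis ht) (ulim_cst 1)).
    apply: (ler_cvg_to l1 (@rlim_harmonic R)); apply: ultraNT => k.
    by have [_ _ /ltW] := hth k.
  apply: cos_inj; rewrite ?in_itv /=.
  - rewrite (rlim_le ht) ?(rlim_ge ht) // => k; have [/andP[h1 h2] _ _] := hth k => //.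
    exact: ltW.
  - by rewrite lexx pi_ge0.
  - by rewrite cos0; move/(congr1 (@complex.Re _)): ct.
have U u : normc2 u = 1 -> 0 <= Im u -> selfsim u.
  move=> nu iu; have [x /andP[x0 _] ->] := cis_arg nu iu.
  pose m k := Num.trunc (x / th k).
  have hm k : `|th k *+ m k - x| <= th k.
    have [/andP[h1 h2] _ _] := hth k.
    have /andP[h3 h4] := truncn_itv (divr_ge0 x0 (ltW h1)).
    move: h3 h4; rewrite -/(m k) ler_pdivlMr // ltr_pdivrMr // -natr1 -mulr_natl.
    by move=> h3 h4; rewrite ler_norml; apply/andP; split; lra.
  have lm : (fun k => th k *+ m k) @ ultraN --> x.
    apply/cvgrPdist_lt => e e0; move: ht; rewrite t0 => ht0.
    apply: filterS (rlim_lt ht0 e0) => k /= hk.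
    by rewrite distrC; apply: le_lt_trans hk.
  apply: (selfsim_closed _ (ulim_cis lm)) => k; rewrite -cisX; apply: selfsimX.
  by have [] := hth k.
move=> u nu; have [iu|iu] := leP 0 (Im u); first exact: U.
rewrite -(invrK u); apply: selfsimV; apply: U; first by rewrite normc2V nu invr1.
by rewrite normc2_1_inv // cImJ oppr_ge0 ltW.
Qed.

(** Two powers of g are close to a common limit, hence their quotient is 1. The orders are bounded:
    elements of growing order would have a limit in G of some finite order j, and their j-th powers,
    close to 1, would be 1. *)
Lemma selfsim_finite (e : R) : 0 < e -> (forall g, selfsim g -> normc2 (g - 1) < e -> g = 1) ->
  exists k, (0 < k)%N /\ forall g, selfsim g -> g ^+ k = 1.
Proof.
move=> e0 disc.
have fin g : selfsim g -> exists j, (0 < j)%N /\ g ^+ j = 1.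
  move=> hg.
  have [l hl] := ulim_exists (fun j => selfsim_le (selfsimX j hg)).
  have e4 : 0 < e / 4 by rewrite divr_gt0.
  have nl := ulim_near hl e4.
  have [i hi] := filter_ex nl.
  have [j [hj ij]] := ultraN2 nl (ultraN_ge i.+1).
  exists (j - i)%N; rewrite subn_gt0; split=> //.
  apply: disc; first exact: selfsimX.
  have -> : normc2 (g ^+ (j - i) - 1) = normc2 ((g ^+ j - l) - (g ^+ i - l)).
    rewrite opprB addrA subrK -[in RHS](subnK (ltnW ij)) exprD.
    have -> : g ^+ (j - i) * g ^+ i - g ^+ i = (g ^+ (j - i) - 1) * g ^+ i by ring.
    by rewrite normc2M normc2X (selfsim_unit hg) expr1n mulr1.
  have /= h := normc2B_le (g ^+ j - l) (g ^+ i - l).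
  by move: hi hj h => /=; lra.
have [[N hN]|noN] := pselect (exists N : nat, forall g, selfsim g ->
    exists j, (0 < j <= N)%N /\ g ^+ j = 1).
  exists N`!; split; first exact: fact_gt0.
  move=> g /hN[j [jN gj]]; have /dvdnP[q ->] := dvdn_fact jN.
  by rewrite mulnC exprM gj expr1n.
exfalso.
have bad N : exists g, selfsim g /\ forall j, (0 < j <= N)%N -> g ^+ j <> 1.
  apply: contrapT => hno; apply: noN; exists N => g hg.
  apply: contrapT => hno'; apply: hno; exists g; split=> // j jN gj.
  by apply: hno'; exists j.
pose g N := projT1 (cid (bad N)).
have hg N : selfsim (g N) /\ forall j, (0 < j <= N)%N -> g N ^+ j <> 1 := projT2 (cid (bad N)).
have [y hy] := ulim_exists (fun N => selfsim_le (hg N).1).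
have Gy := selfsim_closed (fun N => (hg N).1) hy.
have [j [j0 yj]] := fin y Gy.
have := ulimX j hy; rewrite yj => /ulim_near /(_ e0) hn.
have [N [hN jN]] := ultraN2 hn (ultraN_ge j).
apply: ((hg N).2 j); first by rewrite j0.
by apply: disc => //; apply: selfsimX; exact: (hg N).1.
Qed.

Hypothesis lsim_exists : forall v, v != 0 -> exists a c, lsim v a c.

(** The vector v(b) never vanishes on the disc and is u e1 on the circle. The k-th power does not
    depend on the similarity chosen, so even an arbitrary choice [a] gives a continuous function: a
    limit of ratios is a ratio for the limit direction. *)
Lemma selfsim_not_torsion k : (0 < k)%N -> ~ (forall g, selfsim g -> g ^+ k = 1).
Proof.
move=> k0 tors.
pose v (b : R[i]) : Cn R n := b *: e1 + (1 - normc2 b)%:C%C *: e2.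
have nv b : normv2 (v b) = normc2 b + (1 - normc2 b) ^+ 2 by rewrite e12 normc2C.
have v0 b : v b != 0.
  apply/eqP => vb; have := nv b; rewrite vb normv2_0.
  have := normc2_ge0 b; have := sqr_ge0 (1 - 2 * normc2 b); lra.
have vgood b : normc2 b <= 1 -> lgood (v b).
  move=> b1; rewrite /lgood nv; have := normc2_ge0 b.
  have := sqr_ge0 (1 - 2 * normc2 b); nra.
pose a b := projT1 (cid (lsim_exists (v0 b))).
have [c hac] : exists c : R[i] -> R[i], forall b, lsim (v b) (a b) (c b).
  by exists (fun b => projT1 (cid (projT2 (cid (lsim_exists (v0 b)))))) => b;
     exact: (projT2 (cid (projT2 (cid (lsim_exists (v0 b)))))).
have M0 := M_gt0.
have aX b a' c' : lsim (v b) a' c' -> a b ^+ k = a' ^+ k.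
  move=> h; have a'0 := h.1.
  have := tors _ (lsim_div (hac b) h); rewrite expr_div_n => E.
  by rewrite -[LHS](divfK (expf_neq0 k a'0)) E mul1r.
apply: (@no_disc_extension R (fun b => a b ^+ k) k ((r0 / (32 * M)) ^+ k) 1) => //.
- by rewrite exprn_gt0 // divr_gt0 // mulr_gt0.
- move=> b b1; rewrite normc2X lerXn2r ?nnegrE ?normc2_ge0 //.
    by rewrite divr_ge0 ?mulr_ge0 // ltW.
  exact: lsim_a_ge (vgood _ b1) (hac b).
- move=> e e0; apply: contrapT => hno.
  have bad (j : nat) : exists p : R[i] * R[i], [/\ normc2 p.1 <= 1, normc2 p.2 <= 1,
      normc2 (p.1 - p.2) < j.+1%:R^-1 & e <= normc2 (a p.1 ^+ k - a p.2 ^+ k)].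
    apply: contrapT => hno'; apply: hno; exists j.+1%:R^-1; first by rewrite invr_gt0.
    move=> b b' hb hb' hbb'; rewrite ltNge; apply/negP => he.
    by apply: hno'; exists (b, b').
  pose p j := projT1 (cid (bad j)).
  have hp j := projT2 (cid (bad j)) : [/\ normc2 (p j).1 <= 1, normc2 (p j).2 <= 1,
      normc2 ((p j).1 - (p j).2) < j.+1%:R^-1 & e <= normc2 (a (p j).1 ^+ k - a (p j).2 ^+ k)].
  have p1 j : normc2 (p j).1 <= 1 by have [] := hp j.
  have p2 j : normc2 (p j).2 <= 1 by have [] := hp j.
  have L (q : nat -> R[i]) : (forall j, normc2 (q j) <= 1) ->
      exists b, ulim q b /\ ulim (fun j => a (q j) ^+ k) (a b ^+ k).
    move=> q1; have [b hb] := ulim_exists q1.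
    have [a' ha'] := ulim_exists (fun j => lsim_a_le (vgood _ (q1 j)) (hac (q j))).
    have [c' hc'] := ulim_exists (fun j => lsim_c_le (vgood _ (q1 j)) (hac (q j))).
    exists b; split=> //.
    have hv : vlim (fun j => v (q j)) (v b).
      apply: vlimD; first exact: vlimZ hb (vlim_cst _).
      apply: vlimZ (vlim_cst _); apply: ulimC.
      by apply: cvgB; [exact: cvg_cst|exact: ulim_normc2].
    have h := lsim_closed (fun j => vgood _ (q1 j)) (fun j => hac (q j)) hv ha' hc'.
    by rewrite (aX _ _ _ h); exact: ulimX.
  have [b [hb hab]] := L _ p1; have [b' [hb' hab']] := L _ p2.
  have bb' : b = b'.
    apply/eqP; rewrite -subr_eq0; apply/eqP/normc2_eq0/eqP; rewrite eq_le normc2_ge0 andbT.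
    apply: (ler_cvg_to (ulim_normc2 (ulimB hb hb')) (@rlim_harmonic R)).
    by apply: ultraNT => j; have [_ _ /ltW] := hp j.
  have := rlim_ge (ulim_normc2 (ulimB hab hab')) (fun j => let: And4 _ _ _ h := hp j in h).
  by rewrite bb' subrr normc2_0 leNgt e0.
- move=> u u1.
  have u0 : u != 0 by apply/eqP => u0; move: u1; rewrite u0 normc2_0 => /eqP;
    rewrite eq_sym oner_eq0.
  (* v(u) spans the same line as [e1], so u a(u) is in G and its k-th power is 1. *)
  have E : v u = u *: e1 by rewrite /v u1 subrr rmorph0 scale0r addr0.
  have := hac u; rewrite E => /(lsim_scale u0) h.
  by rewrite -exprMn; apply: tors; exists (u * c u).
Qed.

Lemma unit_lgrp u : normc2 u = 1 -> selfsim u.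
Proof.
move: u; apply: selfsim_dense => e e0; apply: contrapT => hno.
have [|k [k0 hk]] := @selfsim_finite e e0; last exact: selfsim_not_torsion k0 hk.
by move=> g hg ge; apply: contrapT => g1; apply: hno; exists g.
Qed.

(** As -1 is in G, the section has a centre z0. The centre is unique, hence fixed by all
    self-similarities, which makes the section invariant under all rotations about z0. Convexity
    fills the disc up to the largest radius. *)
Lemma lsec_disc : exists c (rho : R), 0 < rho /\ forall z, lsec e1 z <-> normc2 (z - c) <= rho.
Proof.
have N1 : normc2 (-1 : R[i]) = 1 by rewrite normc2N normc2_1.
have [c0 [_ hc0]] := unit_lgrp N1.
pose z0 := c0 / 2.
have two0 : (2 : R[i]) != 0 by rewrite pnatr_eq0.
have sym w : lsec e1 (z0 + w) -> lsec e1 (z0 - w).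
  by move=> /hc0; have -> : -1 * (z0 + w) + c0 = z0 - w by rewrite /z0; field.
have bd z : lsec e1 z -> normc2 z <= 2 * M by exact: (lsec_good_le good_e1).
(* Reflections in two different centres compose to a translation, whose iterates leave the bounded
   section. *)
have centre z1 : (forall w, lsec e1 (z1 + w) -> lsec e1 (z1 - w)) -> z1 = z0.
  move=> sym1; apply/eqP; rewrite -subr_eq0; apply/negP => /negP dz.
  have trans k : lsec e1 ((z1 - z0) *+ (2 * k)).
    elim: k => [|k IH]; first by rewrite muln0 mulr0n; exact: lsec_0.
    move: IH; set x := _ *+ (2 * k) => hx.
    have h1 : lsec e1 (z0 - (x - z0)) by apply: sym; rewrite addrC subrK.
    have := sym1 (z0 - (x - z0) - z1); rewrite addrC subrK => /(_ h1).
    have -> // : z1 - (z0 - (x - z0) - z1) = (z1 - z0) *+ (2 * k.+1).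
    by rewrite mulnS mulrnDr -/x; ring.
  have B k : (normc2 (z1 - z0) * 4) * k%:R ^+ 2 <= 2 * M.
    have := bd _ (trans k); rewrite -[_ *+ (2 * k)]mulr_natr normc2M.
    have -> : normc2 ((2 * k)%:R : R[i]) = 4 * k%:R ^+ 2.
      by rewrite -(rmorph_nat (real_complex R)) normc2C natrM; ring.
    by rewrite mulrA.
  have d0 := normc2_gt0 dz; have M0 := M_gt0.
  have B0 : 0 <= 2 * M / normc2 (z1 - z0) by rewrite divr_ge0 ?mulr_ge0 // ltW.
  have := archi_boundP B0; set k := Num.bound _; rewrite ltr_pdivrMr // => hk.
  have := B k; have k1 : (1 : R) <= k%:R.
    by rewrite ler1n lt0n; apply/eqP => k0; move: hk; rewrite k0 mul0r; nra.
  by nra.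
have rot g w : normc2 g = 1 -> lsec e1 (z0 + w) -> lsec e1 (z0 + g * w).
  move=> g1 hw; have [c [g0 hg]] := unit_lgrp g1.
  have E : g * z0 + c = z0.
    apply: centre => x hx.
    have : lsec e1 (z0 + x / g).
      by apply/hg; have -> : g * (z0 + x / g) + c = g * z0 + c + x by field.
    move=> /sym /hg; have -> // : g * (z0 - x / g) + c = g * z0 + c - x by field.
  by move/hg: hw; rewrite mulrDr addrAC E.
have [|w hw|rho [u [hrho [hu lu]]]] :=
  @sup_approx R R[i] [set w | lsec e1 (z0 + w)] (@normc2 R) (4 * M + 2 * normc2 z0).
- by exists (- z0); rewrite /= subrr; exact: lsec_0.
- have := normc2B_le (z0 + w) z0; rewrite (addrC z0) addrK; have := bd _ hw.
  by rewrite (addrC z0); lra.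
have [w hw] : exists w, ulim u w by apply: ulim_exists => k; exact: hrho (hu k).
have Sw : lsec e1 (z0 + w).
  exact: (lsec_closed (vlim_cst e1) (ulimD (ulim_cst z0) hw) hu).
have nw : normc2 w = rho by exact: rlim_unique (ulim_normc2 hw) lu.
have rho0 : 0 < rho.
  have [E|w0] := eqVneq w 0; last by rewrite -nw normc2_gt0.
  have z00 y : lsec e1 y -> y = z0.
    move=> hy; have := hrho (y - z0); rewrite /= addrC subrK => /(_ hy).
    rewrite -nw E normc2_0 => h; apply/eqP; rewrite -subr_eq0; apply/eqP/normc2_eq0/eqP.
    by rewrite eq_le h normc2_ge0.
  have := z00 _ (lsec_s good_e1); rewrite -(z00 _ (lsec_0 e1)) => E0.
  by have := ss; rewrite E0 normc2_0 => E1; have := r0_gt0; lra.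
exists z0, rho; split=> // z; split=> [hz|].
  by apply: hrho; rewrite /= addrC subrK.
set y := z - z0 => hy; have -> : z = z0 + y by rewrite addrC subrK.
have [->|y0] := eqVneq y 0.
  rewrite addr0.
  have := Kcvx (t := 2^-1) Sw (sym _ Sw) ltac:(lra); rewrite /lsec.
  set x := _ + _; have -> // : x = p0 + z0 *: e1.
  have E : 1 - Complex 2^-1 0 = Complex (2^-1 : R) 0 by apply: complex_ext; rewrite !cE /=; lra.
  rewrite /x E -scalerDr.
  have -> : p0 + (z0 + w) *: e1 + (p0 + (z0 - w) *: e1) = (p0 + z0 *: e1) + (p0 + z0 *: e1).
    rewrite scalerDl scalerBl addrACA [RHS]addrACA; congr (_ + _).
    by rewrite addrACA subrr addr0.
  rewrite scalerDr -scalerDl.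
  have -> : Complex 2^-1 0 + Complex 2^-1 0 = 1 :> R[i] by apply: complex_ext;
    rewrite !cE /=; lra.
  by rewrite scale1r.
have y0' := normc2_gt0 y0.
pose q : R := Num.sqrt (rho / normc2 y).
have q2 : q ^+ 2 = rho / normc2 y by rewrite sqr_sqrtr // divr_ge0 // ltW.
have q1 : 1 <= q.
  by rewrite -(ler_pXn2r (n := 2)) ?nnegrE ?sqrtr_ge0 // expr1n q2 ler_pdivlMr // mul1r.
have w0 : w != 0 by apply: contraTneq rho0 => w0; rewrite -nw w0 normc2_0 ltxx.
have Sq : lsec e1 (z0 + q%:C%C * y).
  have -> : q%:C%C * y = (q%:C%C * y / w) * w by rewrite divfK.
  apply: rot => //; rewrite !normc2M normc2V normc2C q2 nw; field.
  by rewrite !gt_eqF.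
have q0 : 0 < q by lra.
(* The weight that writes z0 + y as a convex combination of z0 + q y and z0 - q y. *)
have ht : 0 <= (1 + q^-1) / 2 <= 1.
  have := invf_le1 q0; rewrite q1 => h; have : 0 < q^-1 by rewrite invr_gt0.
  by move=> h2; lra.
have := Kcvx Sq (sym _ Sq) ht; rewrite /lsec; set t := (1 + _) / 2.
set x := _ + _; have -> // : x = p0 + (z0 + y) *: e1.
rewrite /x !scalerDr !scalerA addrACA -scalerDl -scalerDl [Complex _ _ + _]addrC subrK scale1r.
congr (_ + _ *: _).
have -> : Complex t 0 = t%:C%C by [].
have -> : t%:C%C = (1 + q%:C%C^-1) / 2 :> R[i]
  by rewrite /t rmorphM rmorphD /= !fmorphV rmorph_nat rmorph1.
by field; apply/eqP => /(congr1 (@complex.Re _)) /= /eqP; rewrite gt_eqF.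
Qed.
End SectionsThroughInteriorPoint.

(** * Functions with circular plane sections *)

Section PlanarSections.
Variable R : realType.
Implicit Types (Z c w A D : R[i]) (rho t : R).

Lemma normc2_convex A D t : 0 <= t <= 1 ->
  normc2 (t%:C%C * A + (1 - t)%:C%C * D) <= t * normc2 A + (1 - t) * normc2 D.
Proof.
move=> /andP[t0 t1]; rewrite /normc2 !cE /=.
have := sqr_ge0 (Re A - Re D); have := sqr_ge0 (Im A - Im D).
have : 0 <= t * (1 - t) by rewrite mulr_ge0 // subr_ge0.
nra.
Qed.

Lemma disc_open A D rho : normc2 A < rho ->
  exists t, [/\ 0 < t, t <= 1, normc2 (A + t%:C%C * D) <= rho &
                normc2 (A - t%:C%C * D) <= rho].
Proof.
move=> Ar; set B := normc2 A + 2 * normc2 D.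
have B0 : 0 <= B by rewrite addr_ge0 ?mulr_ge0 ?normc2_ge0.
have r0 : 0 < rho - normc2 A by rewrite subr_gt0.
(* For t <= 1 the squared modulus grows by at most t B, and this t keeps t B within the slack rho -
   |A|^2. *)
set t := (rho - normc2 A) / (B + (rho - normc2 A)).
have Br0 : 0 < B + (rho - normc2 A) by lra.
have t0 : 0 < t by rewrite divr_gt0.
have t1 : t <= 1 by rewrite ler_pdivrMr // mul1r lerDr.
have tB : t * B <= rho - normc2 A.
  by rewrite /t mulrAC ler_pdivrMr // ler_pM2l // lerDl ltW.
have D0 := normc2_ge0 D.
have L x : normc2 (A + x%:C%C * D) <=
    normc2 A + `|x| * (normc2 A + normc2 D) + x ^+ 2 * normc2 D.
  rewrite /normc2 !cE /=; have x1 := ler_norm x; have x2 := ler_norm (- x).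
  rewrite normrN in x2; have x0 := normr_ge0 x.
  have := sqr_ge0 (Re A - Re D); have := sqr_ge0 (Im A - Im D).
  have := sqr_ge0 (Re A + Re D); have := sqr_ge0 (Im A + Im D).
  by case: (lerP 0 x) => hx; rewrite ?(ger0_norm hx) ?(ltr0_norm hx); nra.
have tt : t ^+ 2 <= t by rewrite expr2 ler_piMr // ltW.
have F : normc2 A + t * (normc2 A + normc2 D) + t ^+ 2 * normc2 D <= rho.
  by move: tB; rewrite /B; nra.
exists t; split=> //.
  by have := L t; rewrite (ger0_norm (ltW t0)) => h; apply: le_trans h F.
have := L (- t); rewrite normrN (ger0_norm (ltW t0)) sqrrN rmorphN mulNr => h.
exact: le_trans h F.
Qed.

Variable f : R[i] -> R.
(** Every real affine function on the plane is Re (alpha Z + beta), so this concerns all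
    non-vertical planes. *)
Hypothesis fP : forall alpha beta Z1 Z2, Z1 != Z2 ->
  f Z1 <= Re (alpha * Z1 + beta) -> f Z2 <= Re (alpha * Z2 + beta) ->
  exists c rho, 0 < rho /\ forall Z, f Z <= Re (alpha * Z + beta) <-> normc2 (Z - c) <= rho.

(** The affine function interpolating f at Z1 and Z2 cuts out a disc, and discs are convex. *)
Lemma planar_convex Z1 Z2 t : 0 <= t <= 1 ->
  f (t%:C%C * Z1 + (1 - t)%:C%C * Z2) <= t * f Z1 + (1 - t) * f Z2.
Proof.
move=> t01; have [->|Z12] := eqVneq Z1 Z2.
  have -> : t%:C%C * Z2 + (1 - t)%:C%C * Z2 = Z2 by rewrite rmorphB rmorph1; ring.
  by rewrite le_eqVlt; apply/orP; left; apply/eqP; ring.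
have d0 : Z1 - Z2 != 0 by rewrite subr_eq0.
pose al := (f Z1 - f Z2)%:C%C / (Z1 - Z2).
pose be := (f Z1)%:C%C - al * Z1.
have E1 : al * Z1 + be = (f Z1)%:C%C by rewrite /be; ring.
have E2 : al * Z2 + be = (f Z2)%:C%C by rewrite /be /al rmorphB /=; field.
have [||c [rho [rho0 h]]] := fP Z12 (alpha := al) (beta := be); rewrite ?E1 ?E2 //.
have h1 := (h Z1).1 ltac:(by rewrite E1); have h2 := (h Z2).1 ltac:(by rewrite E2).
have -> : t * f Z1 + (1 - t) * f Z2 =
    Re (al * (t%:C%C * Z1 + (1 - t)%:C%C * Z2) + be).
  have -> : al * (t%:C%C * Z1 + (1 - t)%:C%C * Z2) + be =
     t%:C%C * (al * Z1 + be) + (1 - t)%:C%C * (al * Z2 + be) by rewrite rmorphB rmorph1; ring.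
  by rewrite E1 E2 !cE /=; ring.
apply/h; have -> : t%:C%C * Z1 + (1 - t)%:C%C * Z2 - c =
  t%:C%C * (Z1 - c) + (1 - t)%:C%C * (Z2 - c).
  by rewrite rmorphB rmorph1; ring.
apply: (le_trans (normc2_convex _ _ t01)); case/andP: t01 => t0 t1.
by nra.
Qed.

(* Tilting the plane over the chord Z1 Z2 arbitrarily steeply still cuts out a
   disc having the midpoint in its interior, which is impossible if the graph
   of f touches the chord there. *)
Lemma planar_strict Z1 Z2 : Z1 != Z2 -> f ((Z1 + Z2) / 2) < (f Z1 + f Z2) / 2.
Proof.
move=> Z12; set m := (f Z1 + f Z2) / 2; set M := (Z1 + Z2) / 2.
have d0 : Z1 - Z2 != 0 by rewrite subr_eq0.
set d := Z1 - Z2 in d0.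
have two0 : (2 : R[i]) != 0 by rewrite pnatr_eq0.
pose I := Complex (0 : R) 1.
have II : I * I = -1 by apply: complex_ext; rewrite !cE /=; ring.
rewrite ltNge; apply/negP => hm.
(* With this slope, convexity at M between M + x I d and M - I d gives (1 + x) f(M) <= (1 + x) m -
   x, against [hm]. *)
pose tau := f (M - I * d) - m + 1.
pose al := ((f Z1 - f Z2)%:C%C + I * tau%:C%C) / d.
pose be := (f Z1)%:C%C - al * Z1.
have E1 : Re (al * Z1 + be) = f Z1 by rewrite /be addrC subrK.
have E2 : Re (al * Z2 + be) = f Z2.
  have -> : al * Z2 + be = (f Z1)%:C%C - ((f Z1 - f Z2)%:C%C + I * tau%:C%C).
    by rewrite /be /al /d; field.
  by rewrite !cE /=; ring.
have EN x : Re (al * (M + x%:C%C * (I * d)) + be) = m - tau * x.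
  have -> : al * (M + x%:C%C * (I * d)) + be =
     (al * Z1 + be + (al * Z2 + be)) / 2 + x%:C%C * (I * (f Z1 - f Z2)%:C%C + I * I * tau%:C%C).
    by rewrite /M /al; field; rewrite d0.
  rewrite II.
  have -> : (al * Z1 + be + (al * Z2 + be)) / 2 =
     (2^-1 : R)%:C%C * (al * Z1 + be + (al * Z2 + be)).
    by rewrite mulrC; congr (_ * _); rewrite fmorphV rmorph_nat.
  move: (al * Z1 + be) (al * Z2 + be) E1 E2 => u1 u2 E1 E2.
  by rewrite !cE /= E1 E2 /m; ring.
have [||c [rho [rho0 h]]] := fP Z12 (alpha := al) (beta := be); rewrite ?E1 ?E2 //.
have h1 := (h Z1).1 ltac:(by rewrite E1); have h2 := (h Z2).1 ltac:(by rewrite E2).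
have Mc : normc2 (M - c) < rho.
  have : normc2 (M - c) = (normc2 (Z1 - c) + normc2 (Z2 - c)) / 2 - normc2 d / 4.
    have -> : M - c = (2^-1 : R)%:C%C * ((Z1 - c) + (Z2 - c)).
      by rewrite fmorphV rmorph_nat /M; field.
    have -> : d = (Z1 - c) - (Z2 - c) by rewrite /d; ring.
    by rewrite /normc2 !cE /=; field.
  by have := normc2_gt0 d0; lra.
have [x [x0 x1 hx _]] := disc_open (I * d) Mc.
have fx : f (M + x%:C%C * (I * d)) <= m - tau * x.
  by rewrite -EN; apply/h; have -> : M + x%:C%C * (I * d) - c = M - c + x%:C%C * (I * d)
    by ring.
have x1' : 0 < 1 + x by lra.
have x1C : 1 + x%:C%C != 0 :> R[i].
  by apply/eqP => /(congr1 (@complex.Re _)); rewrite !cE /= => /eqP; rewrite gt_eqF.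
have t01 : 0 <= (1 + x)^-1 <= 1 by rewrite invr_ge0 ltW //= invf_le1 // lerDl ltW.
have := planar_convex (M + x%:C%C * (I * d)) (M - I * d) t01.
have -> : (1 + x)^-1%:C%C * (M + x%:C%C * (I * d)) + (1 - (1 + x)^-1)%:C%C * (M - I * d) = M.
  by rewrite rmorphB rmorph1 /= fmorphV rmorphD rmorph1; field.
move=> h3.
have h4 : (1 + x) * f M <= f (M + x%:C%C * (I * d)) + x * f (M - I * d).
  have -> : f (M + x%:C%C * (I * d)) + x * f (M - I * d) =
    (1 + x) * ((1 + x)^-1 * f (M + x%:C%C * (I * d)) + (1 - (1 + x)^-1) * f (M - I * d)).
    by field; rewrite gt_eqF.
  by rewrite ler_pM2l.
by move: h4 fx hm; rewrite /tau; nra.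
Qed.

(** Equality at an interior point contradicts [planar_strict] on a short segment around it. Strict
    inequality on the circle would, by convexity, put points outside the disc below the plane as
    well. *)
Lemma planar_boundary alpha beta c rho : 0 < rho ->
  (forall Z, f Z <= Re (alpha * Z + beta) <-> normc2 (Z - c) <= rho) ->
  forall Z, f Z = Re (alpha * Z + beta) <-> normc2 (Z - c) = rho.
Proof.
move=> rho0 h Z; split=> [E|E].
  apply/eqP; rewrite eq_le (h Z).1 ?E //=; apply/negP => /negP; rewrite -ltNge => lt.
  have [x [x0 x1 h1 h2]] := disc_open 1 lt; rewrite mulr1 in h1 h2.
  have k1 : f (Z + x%:C%C) <= Re (alpha * (Z + x%:C%C) + beta).
    by apply/h; have -> : Z + x%:C%C - c = Z - c + x%:C%C by ring.
  have k2 : f (Z - x%:C%C) <= Re (alpha * (Z - x%:C%C) + beta).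
    by apply/h; have -> : Z - x%:C%C - c = Z - c - x%:C%C by ring.
  have ne : Z + x%:C%C != Z - x%:C%C.
    apply/eqP => /(congr1 (@complex.Re _)); rewrite !cE /= => hh.
    by have : x = 0 by [lra]; move: x0 => /[swap] ->; rewrite ltxx.
  have := planar_strict ne.
  have -> : (Z + x%:C%C + (Z - x%:C%C)) / 2 = Z by field.
  by move: k1 k2; rewrite E !cE /=; lra.
apply/eqP; rewrite eq_le (h Z).2 ?E //= leNgt; apply/negP => lt.
set g0 := Re (alpha * Z + beta) - f Z; have g0p : 0 < g0 by rewrite subr_gt0.
set n := Z - c in E.
have out x : 0 < x -> Re (alpha * (Z + x%:C%C * n) + beta) < f (Z + x%:C%C * n).
  move=> x0; rewrite ltNge; apply/negP => /h.
  have -> : Z + x%:C%C * n - c = (1 + x)%:C%C * n by rewrite rmorphD rmorph1 /n; ring.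
  rewrite normc2M E normc2C; have := mulr_gt0 x0 rho0.
  by have := mulr_ge0 (sqr_ge0 x) (ltW rho0); lra.
set g1 := f (Z + n) - Re (alpha * (Z + n) + beta).
have g1p : 0 < g1.
  by have := out 1 ltr01; rewrite rmorph1 mul1r subr_gt0.
(* Where the chord of the graph from Z to Z + n crosses the plane. *)
set x := g0 / (g0 + g1).
have g01 : 0 < g0 + g1 by lra.
have x0 : 0 < x by rewrite divr_gt0.
have x01 : 0 <= x <= 1 by rewrite ltW //= ler_pdivrMr // mul1r; lra.
have xg : x * (g0 + g1) = g0 by rewrite divfK // gt_eqF.
have := planar_convex (Z + n) Z x01.
have -> : x%:C%C * (Z + n) + (1 - x)%:C%C * Z = Z + x%:C%C * n by rewrite rmorphB rmorph1; ring.
have := out x x0; have -> : Re (alpha * (Z + x%:C%C * n) + beta) =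
   x * Re (alpha * (Z + n) + beta) + (1 - x) * Re (alpha * Z + beta).
  by rewrite !cE /=; ring.
by move: xg; rewrite /g0 /g1; nra.
Qed.

(* The paraboloid through one circular section and one further point of the
   graph meets every plane through that point and two points of the circle in
   the same circle as the graph. *)
Lemma planar_quadratic : exists (a : R) (b : R[i]) (e : R),
  0 < a /\ forall Z, f Z = a * normc2 Z + Re (b * Z) + e.
Proof.
(* A level strictly above two values, so that the horizontal section is a disc with 0 in its
   interior. *)
pose t := Num.max (f 0) (f 1) + 1.
have t0 : f 0 < t by rewrite /t ltr_pwDr // le_max lexx.
have t1 : f 1 < t by rewrite /t ltr_pwDr // le_max lexx orbT.
have E0 Z : Re (0 * Z + t%:C%C) = t by rewrite mul0r add0r.
have [|||c0 [rho0 [rho0p h0]]] := fP (Z1 := 0) (Z2 := 1) (alpha := 0) (beta := t%:C%C);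
  rewrite ?E0 ?ltW //.
  by rewrite eq_sym oner_eq0.
have B0 := planar_boundary rho0p h0.
have n0 : normc2 c0 < rho0.
  have := (h0 0).1; rewrite E0 sub0r normc2N => /(_ (ltW t0));
    rewrite le_eqVlt => /orP[/eqP E|//].
  by have := (B0 0).2; rewrite E0 sub0r normc2N E => /(_ erefl) E'; rewrite E' ltxx in t0.
(* Makes the paraboloid q through the circle agree with f at 0. *)
pose a := (t - f 0) / (rho0 - normc2 c0).
have ap : 0 < a by rewrite divr_gt0 // subr_gt0.
have a0 : a != 0 by rewrite gt_eqF.
pose q Z := t + a * (normc2 (Z - c0) - rho0).
have q0 : q 0 = f 0.
  rewrite /q sub0r normc2N /a; field.
  by rewrite subr_eq0 gt_eqF.
suff fq Z : f Z = q Z.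
  exists a, (- (2 * a)%:C%C * conjc c0), (t + a * (normc2 c0 - rho0)); split=> // Z.
  by rewrite fq /q /normc2 !cE /=; ring.
have [->//|u0] := eqVneq Z 0; move: Z u0 => u u0.
have nu := normc2_gt0 u0.
pose dl := q u - f 0; pose tau := t - f 0.
have tau0 : 0 < tau by rewrite subr_gt0.
pose g := c0 / u; pose A := tau - dl * Re g.
(* Planes through the points of q over 0 and u have slope k = (dl + I sg) / u with sg free. Their
   line at level t meets the circle twice if e^2 < rho0 |k|^2, where e = A + sg Im g. A large sg of
   the right sign achieves this since |g|^2 < rho0 / |u|^2, that is, since 0 is interior. *)
have [sg [sg0 sgh sgb]] : exists sg : R, [/\ sg != 0, A * (sg * Im g) <= 0 &
    A ^+ 2 + normc2 g * sg ^+ 2 < rho0 / normc2 u * sg ^+ 2].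
  have CB : 0 < rho0 / normc2 u - normc2 g.
    by rewrite /g normc2M normc2V subr_gt0 ltr_pM2r // invr_gt0.
  pose s := A ^+ 2 / (rho0 / normc2 u - normc2 g) + 1.
  have s1 : 1 <= s by rewrite lerDr divr_ge0 ?sqr_ge0 // ltW.
  have sb : A ^+ 2 < (rho0 / normc2 u - normc2 g) * s ^+ 2.
    apply: (@lt_le_trans _ _ ((rho0 / normc2 u - normc2 g) * s)).
      rewrite /s mulrDr mulr1 mulrC divfK; first by rewrite ltrDl.
      by rewrite gt_eqF.
    by rewrite ler_pM2l // expr2 ler_peMl // (le_trans ler01).
  have [hA|hA] := leP (A * Im g) 0.
    exists s; split; [by rewrite gt_eqF // (lt_le_trans ltr01)| |by lra].
    by rewrite mulrCA pmulr_rle0 // (lt_le_trans ltr01).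
  exists (- s); split.
  - by rewrite oppr_eq0 gt_eqF // (lt_le_trans ltr01).
  - by rewrite mulrCA mulNr oppr_le0 mulr_ge0 ?(ltW hA) // (le_trans ler01).
  - by rewrite sqrrN; lra.
pose I := Complex (0 : R) 1.
pose k := (dl%:C%C + I * sg%:C%C) / u.
have nk : normc2 k = (dl ^+ 2 + sg ^+ 2) / normc2 u.
  by rewrite /k normc2M normc2V; congr (_ / _); rewrite /normc2 !cE /=; ring.
have k0 : k != 0.
  apply/eqP => k0; move: nk; rewrite k0 normc2_0 => /eqP; rewrite eq_sym gt_eqF // divr_gt0 //.
  by rewrite ltr_wpDl ?sqr_ge0 // lt_neqAle sqr_ge0 andbT eq_sym sqrf_eq0.
have ku : Re (k * u) = dl by rewrite divfK // !cE /=; ring.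
pose e := tau - Re (k * c0).
have eE : e = A + sg * Im g.
  rewrite /e; have -> : k * c0 = (dl%:C%C + I * sg%:C%C) * g by rewrite /k /g; field.
  by rewrite /A !cE /=; ring.
have H2 : 0 < rho0 * normc2 k - e ^+ 2.
  rewrite nk eE subr_gt0.
  have : (sg * Im g) ^+ 2 <= normc2 g * sg ^+ 2.
    by rewrite exprMn mulrC ler_wpM2r ?sqr_ge0 // lerDr sqr_ge0.
  have : 0 <= rho0 * (dl ^+ 2 / normc2 u) by rewrite mulr_ge0 ?divr_ge0 ?sqr_ge0 // ltW.
  have -> : rho0 * ((dl ^+ 2 + sg ^+ 2) / normc2 u) =
    rho0 * (dl ^+ 2 / normc2 u) + rho0 / normc2 u * sg ^+ 2 by ring.
  have -> : (A + sg * Im g) ^+ 2 = A ^+ 2 + 2 * (A * (sg * Im g)) + (sg * Im g) ^+ 2 by ring.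
  by move: sgb sgh; lra.
pose H := Num.sqrt (rho0 * normc2 k - e ^+ 2).
have HH : H ^+ 2 = rho0 * normc2 k - e ^+ 2 by rewrite sqr_sqrtr // ltW.
have Hp : 0 < H by rewrite sqrtr_gt0.
(* For s = 1 and s = -1, the intersections of the circle with the line Re (k Z) = tau. *)
pose cc (s : R) := c0 + Complex e (s * H) / k.
have ccq s : s ^+ 2 = 1 -> f (cc s) = t /\ q (cc s) = t.
  move=> s1; have E : normc2 (cc s - c0) = rho0.
    rewrite addrC addKr normc2M normc2V.
    have -> : normc2 (Complex e (s * H)) = rho0 * normc2 k.
      by rewrite /normc2 /= exprMn s1 mul1r HH -/(normc2 k); ring.
    by rewrite mulfK // gt_eqF // normc2_gt0.
  split; last by rewrite /q E subrr mulr0 addr0.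
  by rewrite -(E0 (cc s)); apply/B0.
have ccl s : Re (k * cc s + (f 0)%:C%C) = t.
  have -> : k * cc s = k * c0 + Complex e (s * H) by rewrite /cc; field.
  by rewrite 2!cReD /= /e /tau; ring.
have s1 : (1 : R) ^+ 2 = 1 by rewrite expr1n.
have s2 : (-1 : R) ^+ 2 = 1 by rewrite sqrrN expr1n.
have ne : cc 1 != cc (-1).
  apply/eqP => /addrI /(mulIf (_ : k^-1 != 0)); rewrite invr_eq0 => /(_ k0) [] hh.
  by have : H = 0 by [lra]; move=> H0; rewrite H0 ltxx in Hp.
have [||c [rho [rhop h]]] := fP ne (alpha := k) (beta := (f 0)%:C%C).
- by rewrite ccl (ccq 1 s1).1.
- by rewrite ccl (ccq _ s2).1.
have B := planar_boundary rhop h.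
(* Quadratic terms cancel, so [D] is affine. It vanishes at 0 and at both points [cc], not collinear
   because tau > 0, hence everywhere. As the plane passes through q(u), the point u is on the second
   circle. *)
pose D Z := q Z - (Re (k * Z + (f 0)%:C%C) + a * (normc2 (Z - c) - rho)).
pose m := (2 * a)%:C%C * (conjc c - conjc c0) - k.
have DE Z : D Z = D 0 + Re (m * Z).
  by rewrite /D /q /m /normc2 !cE /=; ring.
have D0 : D 0 = 0.
  by rewrite /D q0 (B 0).1 ?mulr0 ?add0r //= subrr mulr0 addr0 subrr.
have Dcc s : s ^+ 2 = 1 -> Re (m * cc s) = 0.
  move=> hs; have := DE (cc s); rewrite D0 add0r => <-.
  have [h1 h2] := ccq s hs.
  by rewrite /D h2 ccl (B (cc s)).1 ?ccl // subrr mulr0 addr0 subrr.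
have m0 : m = 0.
  pose r := m / k.
  have Er s : m * cc s = r * (k * cc s) by rewrite /r; field.
  have Ek s : Re (k * cc s) = tau by have := ccl s; rewrite cReD /= /tau => <-; ring.
  have Ik s : Im (k * cc s) = Im (k * c0) + s * H.
    by have -> : k * cc s = k * c0 + Complex e (s * H) by [rewrite /cc; field]; rewrite cImD.
  have r1 := Dcc _ s1; have r2 := Dcc _ s2.
  rewrite Er (cReM r) Ek Ik in r1; rewrite Er (cReM r) Ek Ik in r2.
  have i0 : Im r = 0.
    have : (Im r * H) = 0 by lra.
    by move=> /eqP; rewrite mulf_eq0 (gt_eqF Hp) orbF => /eqP.
  have re0 : Re r = 0.
    by move: r1; rewrite i0 mul0r subr0 => /eqP; rewrite mulf_eq0 (gt_eqF tau0) orbF => /eqP.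
  have r0 : r = 0 by apply: complex_ext.
  by rewrite -(divfK k0 m) -/r r0 mul0r.
have lu : Re (k * u + (f 0)%:C%C) = q u by rewrite cReD ku /= /dl subrK.
have : D u = 0 by rewrite DE D0 m0 mul0r addr0.
rewrite /D lu => hD.
have : normc2 (u - c) = rho.
  have : a * (normc2 (u - c) - rho) = 0 by lra.
  by move=> /eqP; rewrite mulf_eq0 (negbTE a0) subr_eq0 => /eqP.
by move=> /B; rewrite lu.
Qed.
End PlanarSections.

(** * Lines through the farthest point *)

Lemma scale_combine (C : comNzRingType) (V : lmodType C) (a k : V) (h s1 s2 eta e : C) :
  h * (s1 + s2) = e -> h * (s1 - s2) * eta = e ->
  h *: (s1 *: (a + eta *: k)) + h *: (s2 *: (a - eta *: k)) = e *: (a + k).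
Proof.
move=> F1 F2; rewrite !(scalerDr, scalerN, scalerA) addrACA -scalerDl -scalerBl.
by congr (_ *: _ + _ *: _); [rewrite -F1|rewrite -F2]; ring.
Qed.

Section TangentAtOrigin.
(** In the application [B] is x0 - K, [lam] is the Hermitian pairing with x0, and [q] is x0 minus
    the centre of a ball in K. *)
Variables (R : realType) (n : nat) (B : set (Cn R n)) (lam : Cn R n -> R[i]).
Variables (q : Cn R n) (r : R).
Hypothesis lamD : forall x y, lam (x + y) = lam x + lam y.
Hypothesis lamZ : forall a x, lam (a *: x) = a * lam x.
Hypothesis Bcvx : Defs.convex_set B.
Hypothesis B0 : B 0.
Hypothesis Bdisc : forall p v z1 z2, v != 0 -> z1 != z2 -> B (p + z1 *: v) -> B (p + z2 *: v) ->
  exists c (rho : R), 0 < rho /\ forall z, B (p + z *: v) <-> normc2 (z - c) <= rho.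
Hypothesis Bball : forall x, normv2 (x - q) < r -> B x.
Hypothesis r_gt0 : 0 < r.
Hypothesis q_neq0 : q != 0.
Hypothesis Blam : forall y, B y -> y != 0 -> 0 < Re (lam y).
Implicit Types (x y u v d k : Cn R n) (a z s W : R[i]).

Lemma linear0 : lam 0 = 0.
Proof. by rewrite -(scale0r 0) lamZ mul0r. Qed.

Lemma normalized_neq0 u : lam u = 1 -> u != 0.
Proof. by move=> u1; apply/eqP => u0; move: u1; rewrite u0 linear0 => /eqP;
  rewrite eq_sym oner_eq0. Qed.

(** The disc contains 0 and lies in Re z >= 0. Its leftmost point gives rho <= (Re c)^2, while |c|^2
    <= rho; hence tangency at 0, with m the inverse of the diameter. *)
Lemma tangent_disc u s : lam u = 1 -> s != 0 -> B (s *: u) ->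
  exists2 m : R, 0 < m & forall z, B (z *: u) <-> m * normc2 z <= Re z.
Proof.
move=> u1 s0 Bs; have u0 := normalized_neq0 u1.
have B00 : B (0 + 0 *: u) by rewrite add0r scale0r.
have Bs0 : B (0 + s *: u) by rewrite add0r.
have s0' : 0 != s by rewrite eq_sym.
have [c [rho [rho0 h]]] := Bdisc u0 s0' B00 Bs0.
have {}h z : B (z *: u) <-> normc2 (z - c) <= rho by rewrite -h add0r.
have c0 : normc2 c <= rho by have := (h 0).1; rewrite scale0r sub0r normc2N; apply.
have pos z : B (z *: u) -> 0 <= Re z.
  move=> Bz; have [->|z0] := eqVneq z 0; first by rewrite cE.
  by apply/ltW; have := Blam Bz; rewrite lamZ u1 mulr1; apply; rewrite scaler_eq0 negb_or z0.
have sq0 := sqrtr_ge0 rho.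
have sq2 : Num.sqrt rho ^+ 2 = rho by rewrite sqr_sqrtr // ltW.
have sqp : 0 < Num.sqrt rho by rewrite sqrtr_gt0.
have : 0 <= Re (c - (Num.sqrt rho)%:C%C).
  by apply/pos/h; rewrite addrAC subrr sub0r normc2N normc2C sq2.
rewrite !cE /= => c1.
have c2 : rho <= Re c ^+ 2 by rewrite -sq2; nra.
have i0 := sqr_ge0 (Im c).
have E : Im c ^+ 2 = 0 by move: c0; rewrite /normc2; lra.
have E' : Re c ^+ 2 = rho by move: c0; rewrite /normc2; lra.
have rc0 : 0 < Re c by lra.
exists (2 * Re c)^-1; first by rewrite invr_gt0 mulr_gt0.
move=> z; rewrite h mulrC ler_pdivrMr ?mulr_gt0 //.
have ic : Im c = 0 by apply/eqP; rewrite -sqrf_eq0 E.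
have -> : normc2 (z - c) = normc2 z - 2 * (Re c * Re z) + rho.
  by rewrite /normc2 !cE ic -E'; ring.
by split; lra.
Qed.

Let lq := lam q.
Let lq_gt0 : 0 < Re lq.
Proof. by apply: Blam => //; apply: Bball; rewrite subrr normv2_0. Qed.
Let lq_neq0 : lq != 0.
Proof. by apply: contraTneq lq_gt0 => ->; rewrite cE ltxx. Qed.

Lemma tangent_disc_near d : lam d = 0 -> normv2 (lq *: d) < r ->
  exists2 m : R, 0 < m & forall z, B (z *: (lq^-1 *: q + d)) <-> m * normc2 z <= Re z.
Proof.
move=> d0 dr; apply: (@tangent_disc _ lq) => //; first by rewrite lamD lamZ d0 addr0 mulVf.
by apply: Bball; rewrite scalerDr scalerA divff // scale1r addrC addKr.
Qed.

(* The half planes of two complex lines close to that of q have sums that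
   cover a point of every line transverse to the kernel of lam. *)
Lemma tangent_transverse u : lam u = 1 -> exists2 s, s != 0 & B (s *: u).
Proof.
move=> u1; pose k := u - lq^-1 *: q.
have k0 : lam k = 0 by rewrite /k -scaleN1r lamD !lamZ u1 mulVf // mulr1 subrr.
pose M : R := 1 + normc2 lq * normv2 k / r.
have M1 : 1 <= M by rewrite lerDl divr_ge0 ?mulr_ge0 ?normc2_ge0 ?normv2_ge0 // ltW.
have M0 : 0 < M by lra.
pose I := Complex (0 : R) 1.
have II : I * I = -1 by apply: complex_ext; rewrite !cE /=; ring.
(* Chosen so that (s1 - s2) eta = s1 + s2 below, which makes the half-sum of the two points a
   multiple of u; [M] keeps both directions near that of q. *)
pose eta := Complex 0 (- (2 * M)^-1).
have neta : normc2 eta = (4 * M ^+ 2)^-1 by rewrite /normc2 /=; field; rewrite gt_eqF.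
have small : normv2 (lq *: (eta *: k)) < r.
  rewrite !normv2Z neta mulrCA mulrC ltr_pdivrMr ?mulr_gt0 ?exprn_gt0 //.
  have : normc2 lq * normv2 k < r * M.
    have -> : r * M = r + normc2 lq * normv2 k by rewrite /M; field; rewrite gt_eqF.
    by rewrite ltrDr.
  by have : M <= 4 * M ^+ 2 by [nra]; have := r_gt0; nra.
have [m1 m10 h1] := @tangent_disc_near (eta *: k) ltac:(by rewrite lamZ k0 mulr0) small.
have [m2 m20 h2] := @tangent_disc_near (- (eta *: k))
  ltac:(by rewrite -scaleN1r !lamZ k0 !mulr0) ltac:(by rewrite scalerN normv2N).
pose T : R := 4^-1 + M ^+ 2.
have T0 : 0 < T by rewrite addr_gt0 // exprn_gt0.
(* Small enough for e (1/2 + i M) and e (1/2 - i M), of squared modulus e^2 T, to lie in both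
   discs. *)
pose e : R := (2 * (m1 + m2) * T)^-1.
have e0 : 0 < e by rewrite invr_gt0 !mulr_gt0 // addr_gt0.
have eE : e * ((m1 + m2) * T) = 2^-1.
  by rewrite /e; field; rewrite !gt_eqF // addr_gt0.
pose s1 := e%:C%C * Complex 2^-1 M; pose s2 := e%:C%C * Complex 2^-1 (- M).
have n1 : normc2 s1 = e ^+ 2 * T by rewrite normc2M normc2C /normc2 /= /T; field.
have n2 : normc2 s2 = e ^+ 2 * T by rewrite normc2M normc2C /normc2 /= /T; field.
have mT1 : 0 < m1 * T by rewrite mulr_gt0.
have mT2 : 0 < m2 * T by rewrite mulr_gt0.
have B1 : B (s1 *: (lq^-1 *: q + eta *: k)).
  by apply/h1; rewrite n1 /s1 !cE /=; nra.
have B2 : B (s2 *: (lq^-1 *: q - eta *: k)).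
  by apply/h2; rewrite n2 /s2 !cE /=; nra.
exists (Complex (e / 2) 0).
  by apply/eqP => -[] /eqP; rewrite gt_eqF // divr_gt0.
have := Bcvx (t := 2^-1) B1 B2 ltac:(lra).
have E : 1 - Complex 2^-1 0 = Complex (2^-1 : R) 0 by apply: complex_ext; rewrite !cE /=; lra.
set x := _ + _; have -> // : x = Complex (e / 2) 0 *: u.
have F1 : Complex 2^-1 0 * (s1 + s2) = Complex (e / 2) 0.
  by apply: complex_ext; rewrite !cE /=; field.
have F2 : Complex 2^-1 0 * (s1 - s2) * eta = Complex (e / 2) 0.
  by apply: complex_ext; rewrite !cE /=; field; rewrite gt_eqF.
have -> : u = lq^-1 *: q + k by rewrite /k addrC subrK.
by rewrite /x E; exact: scale_combine.
Qed.

(** [F u] is the inverse diameter of the disc cut out by the line through 0 and u; off {lam = 1} its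
    value is arbitrary. *)
Lemma tangent_gauge : exists F : Cn R n -> R, forall u, lam u = 1 ->
  0 < F u /\ forall z, B (z *: u) <-> F u * normc2 z <= Re z.
Proof.
have ex u : exists m : R, lam u = 1 -> 0 < m /\ forall z, B (z *: u) <-> m * normc2 z <= Re z.
  have [u1|nu] := pselect (lam u = 1); last by exists 0.
  have [s s0 Bs] := tangent_transverse u1.
  by have [m m0 hm] := tangent_disc u1 s0 Bs; exists m.
by exists (fun u => projT1 (cid (ex u))) => u; exact: (projT2 (cid (ex u))).
Qed.

Variable F : Cn R n -> R.
Hypothesis FP : forall u, lam u = 1 ->
  0 < F u /\ forall z, B (z *: u) <-> F u * normc2 z <= Re z.

(** With z = 1/W the tangent disc becomes a half-plane. *)
Lemma gauge_inv u W : lam u = 1 -> W != 0 -> B (W^-1 *: u) <-> F u <= Re W.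
Proof.
move=> u1 W0; have [F0 h] := FP u1; rewrite h normc2V cReV.
by rewrite ler_pM2r // invr_gt0 normc2_gt0.
Qed.

(* Projectively, the sections of B become sublevel sets of F: inversion in the
   parameter turns a disc avoiding 0 into a disc. *)
Lemma gauge_planar u d : lam u = 1 -> lam d = 0 -> d != 0 ->
  forall alpha beta Z1 Z2 : R[i], Z1 != Z2 ->
  F (u + Z1 *: d) <= Re (alpha * Z1 + beta) -> F (u + Z2 *: d) <= Re (alpha * Z2 + beta) ->
  exists c (rho : R), 0 < rho /\
    forall Z, F (u + Z *: d) <= Re (alpha * Z + beta) <-> normc2 (Z - c) <= rho.
Proof.
move=> u1 d0 dn0 al be Z1 Z2 Z12 h1 h2.
have lu Z : lam (u + Z *: d) = 1 by rewrite lamD lamZ d0 mulr0 addr0.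
have Wn0 Z : F (u + Z *: d) <= Re (al * Z + be) -> al * Z + be != 0.
  apply: contraTneq => ->; rewrite cE -ltNge; exact: (FP (lu Z)).1.
(* A constant affine function corresponds to a line parallel to {lam = 0}; its parameter needs no
   inversion. *)
have [al0|al0] := eqVneq al 0.
  have W Z : al * Z + be = be by rewrite al0 mul0r add0r.
  have be0 : be != 0 by have := Wn0 _ h1; rewrite W.
  have BE Z : B (be^-1 *: u + Z *: (be^-1 *: d)) <-> F (u + Z *: d) <= Re (al * Z + be).
    by rewrite W -gauge_inv // scalerDr !scalerA mulrC.
  have v0 : be^-1 *: d != 0 by rewrite scaler_eq0 invr_eq0 negb_or be0.
  have [c [rho [rho0 h]]] := Bdisc v0 Z12 ((BE Z1).2 h1) ((BE Z2).2 h2).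
  by exists c, rho; split=> // Z; rewrite -BE h.
pose p := al^-1 *: d; pose v := u - (be / al) *: d.
have v1 : lam v = 1 by rewrite /v -scaleN1r lamD !lamZ d0 !mulr0 addr0.
have BE Z : al * Z + be != 0 ->
    B (p + (al * Z + be)^-1 *: v) <-> F (u + Z *: d) <= Re (al * Z + be).
  move=> W0; rewrite -(gauge_inv (lu Z) W0).
  suff -> : (al * Z + be)^-1 *: (u + Z *: d) = p + (al * Z + be)^-1 *: v by [].
  rewrite /p /v scalerDr scalerBr !scalerA addrCA -scalerBl; congr (_ + _ *: _).
  by field; rewrite W0 al0.
have W12 : (al * Z1 + be)^-1 != (al * Z2 + be)^-1.
  by apply: contraNneq Z12 => /invr_inj /addIr /(mulfI al0) ->.
have [c [rho [rho0 h]]] := Bdisc (normalized_neq0 v1) W12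
  ((BE _ (Wn0 _ h1)).2 h1) ((BE _ (Wn0 _ h2)).2 h2).
have p0 : p != 0 by rewrite scaler_eq0 invr_eq0 negb_or al0.
have nBp : ~ B p by move=> /Blam /(_ p0); rewrite lamZ d0 mulr0 cE ltxx.
(* The line meets {lam = 0} at p, outside B. So 0 is outside the disc, whose inverse is the disc
   with centre conj c / ka and squared radius rho / ka^2. *)
have rc : rho < normc2 c.
  rewrite ltNge; apply/negP => cr; apply: nBp.
  by have := (h 0).2; rewrite scale0r addr0 sub0r normc2N; apply.
set ka := normc2 c - rho; have ka0 : 0 < ka by rewrite subr_gt0.
have nal := normc2_gt0 al0.
exists ((ka^-1%:C%C * conjc c - be) / al), (rho / ka ^+ 2 / normc2 al).
split; first by rewrite !divr_gt0 // exprn_gt0.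
move=> Z; set W := al * Z + be.
have E : normc2 (Z - (ka^-1%:C%C * conjc c - be) / al) =
    normc2 (W - ka^-1%:C%C * conjc c) / normc2 al.
  have -> : Z - (ka^-1%:C%C * conjc c - be) / al = (W - ka^-1%:C%C * conjc c) / al.
    by rewrite /W; move: (_ * conjc c) => X; field.
  by rewrite normc2M normc2V.
rewrite E ler_pM2r ?invr_gt0 //.
have E2 : normc2 (W - ka^-1%:C%C * conjc c) =
  (ka * normc2 W - 2 * Re (c * W) + 1) / ka + rho / ka ^+ 2.
  have -> : normc2 (W - ka^-1%:C%C * conjc c) =
     normc2 W - 2 * Re (c * W) / ka + normc2 c / ka ^+ 2.
    by rewrite /normc2 !cE /=; field; rewrite gt_eqF.
  have -> : normc2 c = ka + rho by rewrite /ka; ring.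
  by field; rewrite gt_eqF.
rewrite E2 gerDr pmulr_lle0 ?invr_gt0 //.
have [W0|W0] := eqVneq W 0.
  have -> : ka * normc2 W - 2 * Re (c * W) + 1 = 1.
    by rewrite W0 normc2_0 (mulr0 c) cE; ring.
  by split=> [/Wn0|]; rewrite ?ler10 // -/W W0 eqxx.
rewrite -(BE Z W0) h -/W.
have -> : normc2 (W^-1 - c) = (1 - 2 * Re (c * W) + normc2 c * normc2 W) / normc2 W.
  have -> : W^-1 - c = (1 - c * W) / W by field.
  rewrite normc2M normc2V; congr (_ / _).
  by rewrite /normc2 !cE; ring.
rewrite ler_pdivrMr ?normc2_gt0 // /ka.
by split; lra.
Qed.

Lemma gauge_quadratic u d : lam u = 1 -> lam d = 0 ->
  exists (a : R) (b : R[i]) (e : R), (d != 0 -> 0 < a) /\ forall Z : R[i],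
    F (u + Z *: d) = a * normc2 Z + Re (b * Z) + e.
Proof.
move=> u1 d0; have [->|dn0] := eqVneq d 0.
  exists 0, 0, (F u); split; [by move=> /eqP; case|move=> Z].
  by rewrite scaler0 addr0 !mul0r cE addr0 add0r.
have [a [b [e [a0 h]]]] := planar_quadratic (gauge_planar u1 d0 dn0).
by exists a, b, e; split=> // _.
Qed.
End TangentAtOrigin.

(** * Hermitian forms *)

Section HermitianOnLines.
Variables (R : realType) (n : nat).
Implicit Types (x y d : Cn R n) (g Q : Cn R n -> R).

(** No term Re (c Z^2) is allowed, which is what makes the form Hermitian; nothing is assumed
    jointly in several variables. *)
Definition hquad g := forall x y, exists (a : R) (b : R[i]) (e : R),
  forall Z : R[i], g (x + Z *: y) = a * normc2 Z + Re (b * Z) + e.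

(* The conclusion is a rational linear combination, found by linear algebra, of
   the ten third differences E0, E1, ..., E9 in a 5 x 5 grid. *)
Lemma grid_second_difference (g : int -> int -> R) :
  (forall i j a b, g (i + 3 * a) (j + 3 * b) - 3 * g (i + 2 * a) (j + 2 * b) +
                   3 * g (i + a) (j + b) - g i j = 0) ->
  g 1 1 + g 1 (-1) - 2 * g 1 0 = g 0 1 + g 0 (-1) - 2 * g 0 0.
Proof.
move=> h.
have E0 : g (-2) 1 - 3 * g (-2) 0 + 3 * g (-2) (-1) - g (-2) (-2) = 0 := h (-2) (-2) 0 1.
have E1 : g 1 1 - 3 * g 0 0 + 3 * g (-1) (-1) - g (-2) (-2) = 0 := h (-2) (-2) 1 1.
have E2 : g 1 (-1) - 3 * g 0 (-1) + 3 * g (-1) (-1) - g (-2) (-1) = 0 := h (-2) (-1) 1 0.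
have E3 : g (-2) 2 - 3 * g (-2) 1 + 3 * g (-2) 0 - g (-2) (-1) = 0 := h (-2) (-1) 0 1.
have E4 : g 1 0 - 3 * g 0 0 + 3 * g (-1) 0 - g (-2) 0 = 0 := h (-2) 0 1 0.
have E5 : g 1 1 - 3 * g 0 1 + 3 * g (-1) 1 - g (-2) 1 = 0 := h (-2) 1 1 0.
have E6 : g 1 (-1) - 3 * g 0 0 + 3 * g (-1) 1 - g (-2) 2 = 0 := h (-2) 2 1 (-1).
have E7 : g (-1) 1 - 3 * g (-1) 0 + 3 * g (-1) (-1) - g (-1) (-2) = 0 := h (-1) (-2) 0 1.
have E8 : g 2 1 - 3 * g 1 0 + 3 * g 0 (-1) - g (-1) (-2) = 0 := h (-1) (-2) 1 1.
have E9 : g 2 1 - 3 * g 1 1 + 3 * g 0 1 - g (-1) 1 = 0 := h (-1) 1 1 0.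
lra.
Qed.

(** Third differences vanish along every line of the integer grid spanned by x and d, because g is
    quadratic there. *)
Lemma hquad_second_difference g : hquad g -> forall x d,
  g (x + d) + g (x - d) - 2 * g x = g d + g (- d) - 2 * g 0.
Proof.
move=> hg x d; pose G (i j : int) := g (i%:~R *: x + j%:~R *: d).
have := @grid_second_difference G _.
have -> : G 1 1 = g (x + d) by rewrite /G !scale1r.
have -> : G 1 (-1) = g (x - d) by rewrite /G mulrN1z scale1r scaleN1r.
have -> : G 1 0 = g x by rewrite /G scale1r scale0r addr0.
have -> : G 0 1 = g d by rewrite /G scale1r scale0r add0r.
have -> : G 0 (-1) = g (- d) by rewrite /G mulrN1z scaleN1r scale0r add0r.
have -> : G 0 0 = g 0 by rewrite /G !scale0r addr0.
apply => i j a b.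
have [al [be [e he]]] := hg (i%:~R *: x + j%:~R *: d) (a%:~R *: x + b%:~R *: d).
have L (k : nat) : G (i + k%:Z * a) (j + k%:Z * b) = al * (k%:R) ^+ 2 + Re be * k%:R + e.
  have -> : G (i + k%:Z * a) (j + k%:Z * b) =
    g (i%:~R *: x + j%:~R *: d + (k%:R : R[i]) *: (a%:~R *: x + b%:~R *: d)).
    by rewrite /G !rmorphD !rmorphM /= !scalerDl scalerDr !scalerA addrACA.
  rewrite he -(rmorph_nat (real_complex R)) normc2C; congr (_ + _ + _).
  by rewrite !cE /= mulr0 subr0.
have := L 3%N; have := L 2%N; have := L 1%N; have := L 0%N.
rewrite !mul0r !addr0 !mul1r => -> -> -> ->.
by rewrite -!natrX; lra.
Qed.

Lemma jensen_additive (phi : Cn R n -> R) : phi 0 = 0 ->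
  (forall x d, phi (x + d) + phi (x - d) = 2 * phi x) ->
  forall x y, phi (x + y) = phi x + phi y.
Proof.
move=> p0 h x y.
pose k : Cn R n := (2^-1 : R[i]) *: (x + y).
pose d : Cn R n := (2^-1 : R[i]) *: (x - y).
have Ex : k + d = x by apply/rowP => i; rewrite !mxE; field.
have Ey : k - d = y by apply/rowP => i; rewrite !mxE; field.
have Exy : k + k = x + y by apply/rowP => i; rewrite !mxE; field.
have two : phi (k + k) = 2 * phi k by have := h k k; rewrite subrr p0 addr0.
by rewrite -Exy two -(h k d) Ex Ey.
Qed.

Section Homogenization.
Variables (g : Cn R n -> R) (lam : Cn R n -> R[i]).
Hypothesis gq : hquad g.
Hypothesis lamD : forall x y, lam (x + y) = lam x + lam y.
Hypothesis lamZ : forall a x, lam (a *: x) = a * lam x.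

Definition qpart d := (g d + g (- d)) / 2 - g 0.
Definition lpart d := (g d - g (- d)) / 2.

Lemma g_split d : g d = qpart d + lpart d + g 0.
Proof. by rewrite /qpart /lpart; field. Qed.

Lemma line_parts d : exists (a : R) (b : R[i]), forall Z : R[i],
  qpart (Z *: d) = a * normc2 Z /\ lpart (Z *: d) = Re (b * Z).
Proof.
have [a [b [e h]]] := gq 0 d.
have {}h Z : g (Z *: d) = a * normc2 Z + Re (b * Z) + e by rewrite -h add0r.
have g0 : g 0 = e by rewrite -(scale0r d) h normc2_0 !mulr0 cE !add0r.
exists a, b => Z; rewrite /qpart /lpart -scaleNr !h g0 normc2N mulrN cReN.
by split; field.
Qed.

Lemma qpartZ Z d : qpart (Z *: d) = normc2 Z * qpart d.
Proof.
have [a [b h]] := line_parts d.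
by rewrite -[in RHS](scale1r d) !(h _).1 normc2_1; ring.
Qed.

Lemma lpart_real (t : R) d : lpart (t%:C%C *: d) = t * lpart d.
Proof.
have [a [b h]] := line_parts d.
by rewrite -[in RHS](scale1r d) !(h _).2 !cE /=; ring.
Qed.

(** Second differences of g agree at u and -u, so those of the odd part vanish; this is Jensen's
    equation. *)
Lemma lpartD x y : lpart (x + y) = lpart x + lpart y.
Proof.
apply: jensen_additive => [|u d]; first by rewrite /lpart oppr0 subrr mul0r.
have h1 := hquad_second_difference gq u d.
have h2 := hquad_second_difference gq (- u) d.
rewrite /lpart; have -> : - (u + d) = - u - d by rewrite opprD.
have -> : - (u - d) = - u + d by rewrite opprB addrC.
lra.
Qed.

(** The homogenization |lam y|^2 g(y / lam y), each part rewritten so as to make sense where lam y =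
    0. *)
Definition hform y := qpart y + lpart (conjc (lam y) *: y) + g 0 * normc2 (lam y).

Lemma hform_ker y : lam y = 0 -> hform y = qpart y.
Proof.
move=> y0; rewrite /hform y0 normc2_0 mulr0 addr0 conjc0 scale0r.
by rewrite /lpart oppr0 subrr mul0r addr0.
Qed.

Lemma hform_transverse y : lam y != 0 ->
  hform y = normc2 (lam y) * g ((lam y)^-1 *: y).
Proof.
move=> y0; have n0 := normc2_gt0 y0.
rewrite g_split /hform.
have -> : qpart y = normc2 (lam y) * qpart ((lam y)^-1 *: y).
  by rewrite qpartZ normc2V mulrA mulfV ?mul1r // gt_eqF.
have -> : lpart (conjc (lam y) *: y) = normc2 (lam y) * lpart ((lam y)^-1 *: y).
  rewrite -lpart_real scalerA -mul_conjc; congr (lpart (_ *: y)).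
  by field.
by ring.
Qed.

Lemma hformZ Z y : hform (Z *: y) = normc2 Z * hform y.
Proof.
rewrite /hform qpartZ lamZ normc2M scalerA.
have -> : conjc (Z * lam y) * Z = (normc2 Z)%:C%C * conjc (lam y).
  by rewrite rmorphM -mul_conjc; ring.
by rewrite -scalerA lpart_real; ring.
Qed.

Lemma hform_hquad : hquad hform.
Proof.
move=> x y.
have [a1 [b1 [e1 h1]]] := gq x y.
have [a2 [b2 [e2 h2]]] := gq (- x) (- y).
pose wx := lam x; pose wy := lam y.
have [a3 [b3 h3]] := line_parts (conjc wx *: y).
have [a4 [b4 h4]] := line_parts (conjc wy *: x).
exists ((a1 + a2) / 2 + lpart (conjc wy *: y) + g 0 * normc2 wy).
(* [b4] is conjugated because it multiplies conj Z in the expansion below. *)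
exists ((2^-1 : R)%:C%C * (b1 + b2) + b3 + conjc b4 + (2 * g 0)%:C%C * (conjc wx * wy)).
exists ((e1 + e2) / 2 - g 0 + lpart (conjc wx *: x) + g 0 * normc2 wx) => Z.
rewrite /hform lamD lamZ -/wx -/wy.
have -> : qpart (x + Z *: y) =
  (a1 + a2) / 2 * normc2 Z + Re ((2^-1 : R)%:C%C * (b1 + b2) * Z) + (e1 + e2) / 2 - g 0.
  by rewrite /qpart h1 opprD -scalerN h2 !cE /=; field.
have -> : conjc (wx + Z * wy) *: (x + Z *: y) =
    conjc wx *: x + Z *: (conjc wx *: y) +
    (conjc Z *: (conjc wy *: x) + (normc2 Z)%:C%C *: (conjc wy *: y)).
  by rewrite -mul_conjc; apply/rowP => i; rewrite !mxE rmorphD rmorphM /=; ring.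
rewrite !lpartD (h3 Z).2 (h4 (conjc Z)).2 lpart_real.
have -> : normc2 (wx + Z * wy) = normc2 wx + normc2 Z * normc2 wy + 2 * Re (conjc wx * wy * Z).
  by rewrite /normc2 !cE; ring.
rewrite !cE /=; ring.
Qed.
End Homogenization.
End HermitianOnLines.

(** * Positive Hermitian forms as squared norms *)

Section HermitianMatrix.
Local Open Scope sesquilinear_scope.
Variables (R : realType) (n : nat) (Q : Cn R n -> R).
Hypothesis Qq : hquad Q.
Hypothesis QZ : forall Z y, Q (Z *: y) = normc2 Z * Q y.
Hypothesis Qpos : forall y, y != 0 -> 0 < Q y.
Implicit Types (x y z : Cn R n).

Let I := Complex (0 : R) 1.
Let II : I * I = -1. Proof. by apply: complex_ext; rewrite !cE /=; ring. Qed.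

Definition repolar x y := (Q (x + y) - Q (x - y)) / 4.
(** Meant to be conjugate-linear in y, so that its imaginary part is its real part at I y. *)
Definition polar x y := Complex (repolar x y) (repolar x (I *: y)).

Lemma homogeneous0 : Q 0 = 0.
Proof. by rewrite -(scale0r 0) QZ normc2_0 mul0r. Qed.

Lemma homogeneousN y : Q (- y) = Q y.
Proof. by rewrite -scaleN1r QZ normc2N normc2_1 mul1r. Qed.

Lemma repolarC x y : repolar x y = repolar y x.
Proof. by rewrite /repolar (addrC y) -(homogeneousN (x - y)) opprB. Qed.

Lemma repolarZ x y : exists b : R[i], forall Z, repolar x (Z *: y) = Re (b * Z).
Proof.
have [a [b [e h]]] := Qq x y; exists ((2^-1 : R)%:C%C * b) => Z.
rewrite /repolar -scaleNr !h normc2N mulrN cReN.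
have -> : Re ((2^-1 : R)%:C%C * b * Z) = 2^-1 * Re (b * Z) by rewrite !cE /=; ring.
by field.
Qed.

(** Second differences of Q at u + y and u - y agree, so Q(x + y) - Q(x - y) satisfies Jensen's
    equation in x. *)
Lemma repolarDl x x' y : repolar (x + x') y = repolar x y + repolar x' y.
Proof.
rewrite -mulrDl; congr (_ / 4); move: x x'.
apply: jensen_additive => [|u d]; first by rewrite add0r sub0r homogeneousN subrr.
have h1 := hquad_second_difference Qq (u + y) d.
have h2 := hquad_second_difference Qq (u - y) d.
rewrite !(addrAC u _ y) !(addrAC u _ (- y)); lra.
Qed.

Lemma repolarI x y : repolar (I *: x) (I *: y) = repolar x y.
Proof.
rewrite /repolar -scalerDr -scalerBr !QZ.
by rewrite (_ : normc2 I = 1) ?mul1r // /normc2 /= expr0n expr1n add0r.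
Qed.

Lemma repolarNl x y : repolar (- x) y = - repolar x y.
Proof. by rewrite /repolar -(homogeneousN (- x + y)) -(homogeneousN (- x - y)) !opprD !opprK;
  field. Qed.

Lemma polarDl x x' y : polar (x + x') y = polar x y + polar x' y.
Proof. by apply: complex_ext; rewrite !cE /= repolarDl. Qed.

Lemma polarZl a x y : polar (a *: x) y = a * polar x y.
Proof.
have [b h] := repolarZ y x.
have h1 Z : repolar (Z *: x) y = Re (b * Z) by rewrite repolarC h.
have h2 Z : repolar (Z *: x) (I *: y) = Im (b * Z).
  have -> : Z *: x = I *: ((- I * Z) *: x).
    by rewrite scalerA mulrA mulrN II opprK mul1r.
  by rewrite repolarI h1 !cE /=; ring.
by rewrite -[in RHS](scale1r x) /polar !h1 !h2; apply: complex_ext; rewrite !cE /=; ring.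
Qed.

Lemma polarC x y : polar y x = conjc (polar x y).
Proof.
apply: complex_ext; rewrite !cE /=; first exact: repolarC.
rewrite (repolarC x) -repolarNl -scaleNr -(repolarI (_ *: y) x).
by rewrite scalerA mulrN II opprK scale1r.
Qed.

Lemma polar_diag y : polar y y = (Q y)%:C%C.
Proof.
apply: complex_ext => /=.
  rewrite /repolar subrr homogeneous0 -[y + y](_ : 2 *: y = _); last by rewrite scaler_nat.
  by rewrite QZ -(rmorph_nat (real_complex R)) normc2C; field.
rewrite /repolar; have -> : y - I *: y = (- I) *: (y + I *: y).
  by rewrite scalerDr scalerA mulNr II opprK scale1r scaleNr addrC.
have n1 : normc2 (- I) = 1 by rewrite normc2N /normc2 /= expr0n expr1n add0r.
by rewrite QZ n1 mul1r subrr mul0r.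
Qed.

Lemma polar_suml (F : 'I_n -> Cn R n) y : polar (\sum_i F i) y = \sum_i polar (F i) y.
Proof.
have p0 : polar 0 y = 0 by rewrite -(scale0r 0) polarZl mul0r.
by apply: (big_morph (fun x => polar x y)) => // x x'; exact: polarDl.
Qed.

Lemma polar_coords x y : polar x y = \sum_i x ord0 i * polar (delta_mx ord0 i) y.
Proof.
rewrite {1}(row_sum_delta x) polar_suml.
by apply: eq_bigr => i _; rewrite polarZl.
Qed.

Definition gram : 'M[R[i]]_n := \matrix_(i, j) polar (delta_mx ord0 i) (delta_mx ord0 j).

Lemma gram_hermitian : gram \is hermsymmx.
Proof.
apply/is_hermitianmxP; rewrite expr0 scale1r; apply/matrixP => i j.
by rewrite !mxE; exact: polarC.
Qed.

Lemma gramE y : (y *m gram *m y ^t*) ord0 ord0 = (Q y)%:C%C.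
Proof.
rewrite !mxE -polar_diag polarC polar_coords rmorph_sum; apply: eq_bigr => j _.
rewrite !mxE rmorphM mulrC; congr (_ * _).
by rewrite -[RHS]/(conjc (polar _ _)) -polarC polar_coords; apply: eq_bigr => i _; rewrite mxE.
Qed.

(** By the spectral theorem the eigenvalues of the Gram matrix are the values of Q at the rows of a
    unitary matrix, hence positive; P scales the eigencoordinates by their square roots. *)
Lemma hermitian_square_root : exists P : 'M[R[i]]_n, P \in unitmx /\
  forall y, Q y = normv2 (y *m P).
Proof.
pose U := spectralmx gram; pose D := spectral_diag gram.
have Uu : U \is unitarymx := spectral_unitarymx gram.
have Uinv : invmx U = U ^t* := invmx_unitary Uu.
have UU : U *m U ^t* = 1%:M by apply/unitarymxP.
have Uunit : U \in unitmx := unitarymx_unit Uu.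
have HD : gram = U ^t* *m diag_mx D *m U.
  by rewrite -Uinv; apply/orthomx_spectralP/hermitian_normalmx/gram_hermitian.
have QD (t : Cn R n) : (Q (t *m U))%:C%C = \sum_i t ord0 i * D ord0 i * conjc (t ord0 i).
  rewrite -gramE HD trmx_mul map_mxM !mulmxA.
  rewrite -(mulmxA t U) UU mulmx1 -!mulmxA (mulmxA U) UU mul1mx mulmxA.
  rewrite mxE; apply: eq_bigr => i _; rewrite !mxE; congr (_ * _).
  rewrite (bigD1 i) //= big1 ?addr0 => [|j ji]; first by rewrite !mxE eqxx mulr1n.
  by rewrite !mxE (negbTE ji) mulr0n mulr0.
have Di i : D ord0 i = (Q (row i U))%:C%C.
  rewrite rowE QD (bigD1 i) //= big1 ?addr0 => [|j ji].
    by rewrite !mxE !eqxx mul1r conjc1 mulr1.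
  by rewrite !mxE (negbTE ji) andbF !mul0r.
have rowU i : 0 < Q (row i U).
  apply: Qpos; apply/eqP => r0.
  have := mulmxV Uunit; move=> /(congr1 (row i)); rewrite row_mul r0 mul0mx.
  by move=> /rowP/(_ i); rewrite !mxE eqxx => /eqP; rewrite eq_sym oner_eq0.
pose S := \row_i (Num.sqrt (Q (row i U)))%:C%C : 'rV[R[i]]_n.
exists (U ^t* *m diag_mx S); split.
  rewrite unitmx_mul -Uinv unitmx_inv Uunit unitmxE det_diag unitfE /=.
  apply/prodf_neq0 => i _; rewrite mxE; apply/eqP => /(congr1 (@complex.Re _)) /= /eqP.
  by rewrite gt_eqF // sqrtr_gt0.
move=> y; have -> : y = y *m U ^t* *m U by rewrite -Uinv mulmxKV.
move: (y *m U ^t* ) => t.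
apply: (@complexI R); rewrite QD mulmxA -(mulmxA t) UU mulmx1 /normv2 rmorph_sum.
apply: eq_bigr => i _; rewrite Di mulrAC mul_conjc -rmorphM /=.
by rewrite mul_mx_diag mxE [S _ _]mxE normc2M normc2C sqr_sqrtr // ltW.
Qed.
End HermitianMatrix.

Lemma scale_shear (C : pzRingType) (V : lmodType C) (x y w : V) (a b z : C) :
  x + z *: y - (a + z * b) *: w = (x - a *: w) + z *: (y - b *: w).
Proof. by rewrite scalerDl opprD scalerBr scalerA addrACA. Qed.

(** * The body as a sublevel set of a Hermitian form *)

Section TangentForm.
Variables (R : realType) (n : nat) (B : set (Cn R n)) (lam : Cn R n -> R[i]).
Variables (q : Cn R n) (r : R).
Hypothesis lamD : forall x y, lam (x + y) = lam x + lam y.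
Hypothesis lamZ : forall a x, lam (a *: x) = a * lam x.
Hypothesis Bcvx : Defs.convex_set B.
Hypothesis B0 : B 0.
Hypothesis Bdisc : forall p v z1 z2, v != 0 -> z1 != z2 -> B (p + z1 *: v) -> B (p + z2 *: v) ->
  exists c (rho : R), 0 < rho /\ forall z, B (p + z *: v) <-> normc2 (z - c) <= rho.
Hypothesis Bball : forall x, normv2 (x - q) < r -> B x.
Hypothesis r_gt0 : 0 < r.
Hypothesis q_neq0 : q != 0.
Hypothesis Blam : forall y, B y -> y != 0 -> 0 < Re (lam y).

(** The projection [pr] along u0 extends F from {lam = 1} to a function g on the whole space, which
    can be homogenized. On {lam = 0} the body is only the origin, and Q is positive there because
    the leading coefficients of F are. *)
Lemma tangent_form : exists P : 'M[R[i]]_n, P \in unitmx /\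
  forall y, B y <-> normv2 (y *m P) <= Re (lam y).
Proof.
have [F FP] := tangent_gauge lamD lamZ Bcvx B0 Bdisc Bball r_gt0 q_neq0 Blam.
have lamN x : lam (- x) = - lam x by rewrite -scaleN1r lamZ mulN1r.
have lq0 : lam q != 0.
  have : 0 < Re (lam q) by apply: Blam => //; apply: Bball; rewrite subrr normv2_0.
  by apply: contraTneq => ->; rewrite cE ltxx.
pose u0 := (lam q)^-1 *: q.
have u01 : lam u0 = 1 by rewrite lamZ mulVf.
pose pr y := y - lam y *: u0.
have pr0 y : lam (pr y) = 0 by rewrite lamD lamN lamZ u01 mulr1 subrr.
pose g y := F (u0 + pr y).
have gE x y : exists (a : R) (b : R[i]) (e : R), (pr y != 0 -> 0 < a) /\
    forall Z : R[i], g (x + Z *: y) = a * normc2 Z + Re (b * Z) + e.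
  have l1 : lam (u0 + pr x) = 1 by rewrite lamD u01 pr0 addr0.
  have [a [b [e [a0 h]]]] := gauge_quadratic lamD lamZ Bdisc Blam FP l1 (pr0 y).
  exists a, b, e; split=> // Z; rewrite -h /g -addrA; congr (F (_ + _)).
  by rewrite /pr lamD lamZ; exact: scale_shear.
have gq : hquad g by move=> x y; have [a [b [e [_ h]]]] := gE x y; exists a, b, e.
have prE y : lam y = 1 -> u0 + pr y = y by move=> y1; rewrite /pr y1 scale1r addrC subrK.
pose Q := hform g lam.
have Q1 y : lam y != 0 -> Q y = normc2 (lam y) * F ((lam y)^-1 *: y).
  move=> y0; rewrite /Q hform_transverse // /g prE //; last by rewrite lamZ mulVf.
have Qker y : lam y = 0 -> y != 0 -> 0 < Q y.
  move=> y0 yn0; rewrite /Q hform_ker //.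
  have pry : pr y = y by rewrite /pr y0 scale0r subr0.
  have [a [b [e [a0 h]]]] := gE 0 y; rewrite pry in a0.
  have h1 := h 1; have h2 := h (-1); have h3 := h 0.
  rewrite !add0r scale1r in h1; rewrite add0r scaleN1r in h2.
  rewrite add0r scale0r in h3.
  rewrite /qpart h1 h2 h3 normc2N normc2_1 normc2_0 mulrN !cReN (mulr0 b) cRe0.
  by have := a0 yn0; lra.
have QB y : B y <-> Q y <= Re (lam y).
  have [y0|y0] := eqVneq (lam y) 0.
    rewrite y0; have [->|yn0] := eqVneq y 0.
      have := hformZ gq lamZ 0 (0 : Cn R n); rewrite scale0r normc2_0 mul0r => E.
      by rewrite /Q E cRe0 lexx.
    split=> [/Blam/(_ yn0)|]; first by rewrite y0 ltxx.
    by rewrite cRe0 leNgt Qker.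
  have l1 : lam ((lam y)^-1 *: y) = 1 by rewrite lamZ mulVf.
  have := (FP _ l1).2 (lam y); rewrite scalerA divff // scale1r => ->.
  by rewrite Q1 // mulrC.
have Qpos y : y != 0 -> 0 < Q y.
  move=> yn0; have [y0|y0] := eqVneq (lam y) 0; first exact: Qker.
  rewrite Q1 // mulr_gt0 ?normc2_gt0 //.
  have l1 : lam ((lam y)^-1 *: y) = 1 by rewrite lamZ mulVf.
  exact: (FP _ l1).1.
have Qq : hquad Q by exact: hform_hquad.
have QZ Z y : Q (Z *: y) = normc2 Z * Q y by exact: hformZ.
have [P [Pu QP]] := hermitian_square_root Qq QZ Qpos.
by exists P; split=> // y; rewrite QB QP.
Qed.

Lemma lam_coords (P : 'M[R[i]]_n) (t : Cn R n) :
  lam (t *m P) = \sum_i t ord0 i * lam (row i P).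
Proof.
have lam0 : lam 0 = 0 by rewrite -(scale0r 0) lamZ mul0r.
rewrite mulmx_sum_row (big_morph lam (id1 := 0) (op1 := +%R)) //.
by apply: eq_bigr => i _; rewrite lamZ.
Qed.

(** Completing the square in |y P|^2 - Re (lam y). The radius is positive, as otherwise B would be
    the origin alone and miss q. *)
Lemma tangent_ball : exists (P : 'M[R[i]]_n) (mu : Cn R n) (rho : R),
  [/\ P \in unitmx, 0 < rho & forall y, B y <-> normv2 (y *m P - mu) <= rho].
Proof.
have [P [Pu h]] := tangent_form.
pose mu : Cn R n := \row_i (conjc (lam (row i (invmx P))) / 2).
have E y : normv2 (y *m P - mu) = normv2 (y *m P) - Re (lam y) + normv2 mu.
  have -> : lam y = \sum_i (y *m P) ord0 i * lam (row i (invmx P)).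
    by rewrite -lam_coords mulmxK.
  rewrite /normv2 (big_morph (@complex.Re R) (id1 := 0) (op1 := +%R)) //; last exact: cReD.
  rewrite -sumrB -big_split /=; apply: eq_bigr => i _.
  rewrite !mxE; set t := \sum_j _; set l := lam _.
  have -> : conjc l / 2 = (2^-1 : R)%:C%C * conjc l.
    by rewrite mulrC fmorphV rmorph_nat.
  by rewrite /normc2 !cE /=; field.
exists P, mu, (normv2 mu); split=> // [|y]; last first.
  by rewrite h E gerDr subr_le0.
rewrite lt_neqAle normv2_ge0 andbT eq_sym; apply/eqP => mu0.
have Bq : B q by apply: Bball; rewrite subrr normv2_0.
have single y : B y -> y = 0.
  move=> /h; rewrite -subr_le0 => hy.
  have := E y; have := normv2_ge0 (y *m P - mu); rewrite mu0 addr0 => h1 h2.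
  have /normv2_eq0 : normv2 (y *m P - mu) = 0 by lra.
  have /normv2_eq0 -> := mu0; rewrite subr0 => /(congr1 (mulmx^~ (invmx P))).
  by rewrite mulmxK // mul0mx.
by have := q_neq0; rewrite (single q Bq) eqxx.
Qed.
End TangentForm.

(** * The characterization *)

Section LineSections.
Variables (R : realType) (n : nat).
Implicit Types (K : set (Cn R n)) (p v x y : Cn R n).

Definition cline p v : set (Cn R n) := [set p + z *: v | z in [set: R[i]]].

Lemma cline_affine p v : v != 0 -> affine_line (cline p v).
Proof. by move=> v0; exists p, v. Qed.

(** Inverse of z -> p + z v, read off a nonzero coordinate of v and defined on the whole space, so
    that maps between lines are global functions; 0 is the default for v = 0. *)
Definition coord p v x : R[i] :=
  if [pick i | v ord0 i != 0] is Some i then (x ord0 i - p ord0 i) / v ord0 i else 0.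

Lemma coordK p v z : v != 0 -> coord p v (p + z *: v) = z.
Proof.
move=> v0; rewrite /coord; case: pickP => [i vi|v00].
  by rewrite !mxE; field.
by case/eqP: v0; apply/rowP => i; rewrite mxE; have /negbFE/eqP := v00 i.
Qed.

Lemma coord_affine p v x y s : v != 0 ->
  coord p v (s *: x + (1 - s) *: y) = s * coord p v x + (1 - s) * coord p v y.
Proof.
move=> v0; rewrite /coord; case: pickP => [i vi|v00]; first by rewrite !mxE; field.
by case/eqP: v0; apply/rowP => i; rewrite mxE; have /negbFE/eqP := v00 i.
Qed.

Lemma line_param_inj p v (z1 z2 : R[i]) : v != 0 -> p + z1 *: v = p + z2 *: v -> z1 = z2.
Proof. by move=> v0 E; rewrite -(coordK p z1 v0) E coordK. Qed.

Lemma section_similarity K p1 v1 p2 v2 phi : v1 != 0 -> v2 != 0 ->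
  affine_bij_on (cline p1 v1) (cline p2 v2) phi ->
  phi @` (cline p1 v1 `&` K) = cline p2 v2 `&` K ->
  exists a c : R[i], a != 0 /\
    forall z, K (p1 + z *: v1) <-> K (p2 + (a * z + c) *: v2).
Proof.
move=> v10 v20 [aff into inj surj] img.
have L1 z : cline p1 v1 (p1 + z *: v1) by exists z.
(* The affine map is determined by its values at the parameters 0 and 1. *)
have [c _ hc] := into _ (L1 0); have [c' _ hc'] := into _ (L1 1).
have E z : phi (p1 + z *: v1) = p2 + ((c' - c) * z + c) *: v2.
  have -> : p1 + z *: v1 = z *: (p1 + 1 *: v1) + (1 - z) *: (p1 + 0 *: v1).
    by apply/rowP => i; rewrite !mxE; ring.
  rewrite aff // -hc -hc'; apply/rowP => i; rewrite !mxE; ring.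
have a0 : c' - c != 0.
  rewrite subr_eq0; apply/eqP => cc'.
  have /(line_param_inj v10)/eqP : p1 + 1 *: v1 = p1 + 0 *: v1.
    by apply: inj => //; rewrite -hc -hc' cc'.
  by rewrite oner_eq0.
exists (c' - c), c; split=> // z; rewrite -E; split=> [Kz|Kz].
  have : (cline p2 v2 `&` K) (phi (p1 + z *: v1)).
    by rewrite -img; exists (p1 + z *: v1).
  by case.
have : (cline p2 v2 `&` K) (phi (p1 + z *: v1)) by split=> //; exact: into.
rewrite -img => -[x [[z' _ <-] Kx]]; rewrite !E => /(line_param_inj v20) /addIr /(mulfI a0).
by move=> <-.
Qed.

Lemma normv2_line p v : v != 0 -> exists (c : R[i]) (e : R), forall z,
  normv2 (p + z *: v) = normv2 v * normc2 (z - c) + e.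
Proof.
move=> v0; have N0 := normv2_gt0 v0.
pose be := \sum_i v ord0 i * conjc (p ord0 i).
exists (- (normv2 v)^-1%:C%C * conjc be), (normv2 p - normc2 be / normv2 v) => z.
have -> : normv2 (p + z *: v) = normv2 p + normc2 z * normv2 v + 2 * Re (z * be).
  rewrite /normv2 /be !mulr_sumr (big_morph (@complex.Re R) (id1 := 0) (op1 := +%R)) //;
    last exact: cReD.
  rewrite mulr_sumr -!big_split /=; apply: eq_bigr => i _.
  by rewrite !mxE /normc2 !cE; ring.
by rewrite /normc2 !cE /=; field; rewrite gt_eqF.
Qed.

Lemma ellipsoid_ball K : complex_ellipsoid K -> exists (A : 'M[R[i]]_n) (b : Cn R n),
  A \in unitmx /\ forall y, K y <-> normv2 ((y - b) *m A) <= 1.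
Proof.
have ub (x : Cn R n) : unit_ball x <-> normv2 x <= 1.
  rewrite /unit_ball /= /normv2; under eq_bigr do rewrite sqr_norm.
  by rewrite -rmorph_sum -(rmorph1 (real_complex R)) lecR.
move=> [A [b [Au ->]]]; exists (invmx A), b; split; first by rewrite unitmx_inv.
move=> y; split=> [[x /ub hx <-]|hy]; first by rewrite addrK mulmxK.
by exists ((y - b) *m invmx A); [exact/ub|rewrite mulmxKV // subrK].
Qed.

(** Completing the square along the line gives a sublevel set of |z - c|^2; a second point forces a
    positive radius. *)
Lemma ellipsoid_section_disc K p v : complex_ellipsoid K -> v != 0 ->
  nontrivial (cline p v `&` K) ->
  exists (c : R[i]) (rho : R), 0 < rho /\ forall z, K (p + z *: v) <-> normc2 (z - c) <= rho.
Proof.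
move=> /ellipsoid_ball [A [b [Au hA]]] v0 [x [y [[[z1 _ <-] K1] [[[z2 _ <-] K2] ne]]]].
have vA0 : v *m A != 0.
  by apply: contra v0 => /eqP/(congr1 (mulmx^~ (invmx A))); rewrite mulmxK // mul0mx => ->.
have [c [e h]] := normv2_line ((p - b) *m A) vA0.
have N0 := normv2_gt0 vA0.
have {}h z : K (p + z *: v) <-> normc2 (z - c) <= (1 - e) / normv2 (v *m A).
  rewrite hA addrAC mulmxDl -scalemxAl h ler_pdivlMr //.
  by split; lra.
exists c, ((1 - e) / normv2 (v *m A)); split=> //.
rewrite ltNge; apply/negP => r0; apply: ne.
have E z : K (p + z *: v) -> z = c.
  move=> /h hz; apply/eqP; rewrite -subr_eq0; apply/eqP/normc2_eq0/eqP.
  by rewrite eq_le normc2_ge0 andbT (le_trans hz).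
by rewrite (E _ K1) (E _ K2).
Qed.

(** A homothety of ratio sqrt (rho2 / rho1) matching the centres. *)
Lemma discs_equivalent K p1 v1 p2 v2 (c1 c2 : R[i]) (rho1 rho2 : R) :
  v1 != 0 -> v2 != 0 -> 0 < rho1 -> 0 < rho2 ->
  (forall z, K (p1 + z *: v1) <-> normc2 (z - c1) <= rho1) ->
  (forall z, K (p2 + z *: v2) <-> normc2 (z - c2) <= rho2) ->
  exists phi, affine_bij_on (cline p1 v1) (cline p2 v2) phi /\
    phi @` (cline p1 v1 `&` K) = cline p2 v2 `&` K.
Proof.
move=> v10 v20 r1 r2 h1 h2.
pose a : R := Num.sqrt (rho2 / rho1).
have a2 : a ^+ 2 = rho2 / rho1 by rewrite sqr_sqrtr // divr_ge0 // ltW.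
have a0 : a%:C%C != 0 :> R[i].
  apply/eqP => /(congr1 (@complex.Re _)) /= /eqP; rewrite gt_eqF // sqrtr_gt0.
  exact: divr_gt0.
pose m z := a%:C%C * (z - c1) + c2.
have Km z : K (p2 + m z *: v2) <-> K (p1 + z *: v1).
  rewrite h2 h1 /m addrK normc2M normc2C a2 mulrAC ler_pdivrMr //.
  by rewrite ler_pM2l.
pose phi x := p2 + m (coord p1 v1 x) *: v2.
have phiE z : phi (p1 + z *: v1) = p2 + m z *: v2 by rewrite /phi coordK.
have mV w : m ((w - c2) / a%:C%C + c1) = w by rewrite /m addrK mulrC divfK // subrK.
exists phi; split.
  split.
  - move=> x y s _ _; rewrite /phi coord_affine //; apply/rowP => i.
    by rewrite !mxE /m; ring.
  - by move=> x [z _ <-]; rewrite phiE; exists (m z).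
  - move=> x y [z _ <-] [w _ <-]; rewrite !phiE => /(line_param_inj v20).
    by move=> /addIr /(mulfI a0) /addIr ->.
  - move=> y [w _ <-]; exists (p1 + ((w - c2) / a%:C%C + c1) *: v1).
      by exists ((w - c2) / a%:C%C + c1).
    by rewrite phiE mV.
apply/seteqP; split=> [y [x [[z _ <-] Kx] <-]|y [[w _ <-] Ky]].
  by rewrite phiE; split; [exists (m z)|apply/Km].
exists (p1 + ((w - c2) / a%:C%C + c1) *: v1); last by rewrite phiE mV.
by split; [exists ((w - c2) / a%:C%C + c1)|apply/Km; rewrite mV].
Qed.

End LineSections.

(** * From equivalent sections to the ellipsoid *)

Section Characterization.
Variables (R : realType) (n : nat) (K : set (Cn R n)).
Implicit Types (p v x y : Cn R n).
Hypothesis n2 : (2 <= n)%N.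
Hypothesis Kcvx : Defs.convex_set K.
Hypothesis Kcmp : forall u : nat -> Cn R n, (forall k, K (u k)) -> exists l, K l /\ vlim u l.
Variables (p0 : Cn R n) (r0 : R).
Hypothesis r0_gt0 : 0 < r0.
Hypothesis Kball : forall x, normv2 (x - p0) < r0 -> K x.
Hypothesis Ksim : forall p1 v1 p2 v2, v1 != 0 -> v2 != 0 ->
  nontrivial (cline p1 v1 `&` K) -> nontrivial (cline p2 v2 `&` K) ->
  exists a c : R[i], a != 0 /\ forall z, K (p1 + z *: v1) <-> K (p2 + (a * z + c) *: v2).

Lemma normv2_bounded p : exists M : R, forall x, K x -> normv2 (x - p) <= M.
Proof.
apply: contrapT => hno.
have bad (k : nat) : exists x, K x /\ k%:R < normv2 (x - p).
  apply: contrapT => hno'; apply: hno; exists k%:R => x Kx.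
  by rewrite leNgt; apply/negP => h; apply: hno'; exists x.
pose u k := projT1 (cid (bad k)).
have hu k : K (u k) /\ k%:R < normv2 (u k - p) := projT2 (cid (bad k)).
have [l [_ ul]] := Kcmp (fun k => (hu k).1).
have := vlim_normv2 (vlimB ul (vlim_cst p)) => hl.
have hlt := rlim_lt hl (ltac:(by rewrite ltrDl) : normv2 (l - p) < normv2 (l - p) + 1).
have := archi_boundP (ltac:(by rewrite addr_ge0 ?normv2_ge0) : 0 <= normv2 (l - p) + 1).
set N := Num.bound _ => hN.
have [k [hk Nk]] := ultraN2 hlt (ultraN_ge N).
have := (hu k).2; rewrite ltNge => /negP; apply.
by apply: ltW; apply: lt_le_trans hk _; apply: le_trans (ltW hN) _; rewrite ler_nat.
Qed.

Lemma interior_nontrivial v : v != 0 -> nontrivial (cline p0 v `&` K).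
Proof.
move=> v0; have N0 := normv2_gt0 v0.
pose t : R := Num.sqrt (r0 / (2 * normv2 v)).
have t2 : t ^+ 2 = r0 / (2 * normv2 v) by rewrite sqr_sqrtr // divr_ge0 ?mulr_ge0 ?ltW.
have t0 : 0 < t by rewrite sqrtr_gt0 divr_gt0 // mulr_gt0.
exists (p0 + 0 *: v), (p0 + t%:C%C *: v); split; [|split].
- by split; [exists 0|apply: Kball; rewrite addrC addKr scale0r normv2_0].
- split; [by exists t%:C%C|apply: Kball; rewrite addrC addKr normv2Z normc2C t2].
  have -> : r0 / (2 * normv2 v) * normv2 v = r0 / 2 by field; rewrite gt_eqF.
  by have := r0_gt0; lra.
- move=> /(line_param_inj v0) /(congr1 (@complex.Re R)) /= E.
  by rewrite -E ltxx in t0.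
Qed.

(** Dimension at least two enters here, as two orthonormal directions. *)
Let i0 : 'I_n := Ordinal (ltnW n2).
Let i1 : 'I_n := Ordinal n2.
Let e1 : Cn R n := delta_mx ord0 i0.
Let e2 : Cn R n := delta_mx ord0 i1.

Lemma normv2_delta2 a b : normv2 (a *: e1 + b *: e2) = normc2 a + normc2 b.
Proof.
have ne : i1 != i0 by [].
rewrite /normv2 (bigD1 i0) //= (bigD1 i1) //= big1 => [|j /andP[j0 j1]].
  by rewrite !mxE !eqxx /= !mulr0 !mulr1 addr0 add0r addr0.
by rewrite !mxE (negbTE j0) (negbTE j1) /= !mulr0 addr0 normc2_0.
Qed.

(** One section through [p0] is a disc, and similarity carries this to all sections, including those
    of lines that miss [p0]. *)
Lemma section_disc p v z1 z2 : v != 0 -> z1 != z2 -> K (p + z1 *: v) -> K (p + z2 *: v) ->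
  exists c (rho : R), 0 < rho /\ forall z, K (p + z *: v) <-> normc2 (z - c) <= rho.
Proof.
move=> v0 z12 K1 K2.
have e10 : e1 != 0.
  apply/eqP => E; have := normv2_delta2 1 0; rewrite E scaler0 scale0r addr0 normv2_0.
  by rewrite normc2_1 normc2_0 addr0 => /eqP; rewrite eq_sym oner_eq0.
have [M KM] := normv2_bounded p0.
have sim w : w != 0 -> exists a c, lsim K p0 e1 w a c.
  move=> w0; have [a [c [a0 h]]] := Ksim (p1 := p0) (p2 := p0) e10 w0
    (interior_nontrivial e10) (interior_nontrivial w0).
  by exists a, c.
have [c0 [rho0 [rho00 h0]]] := lsec_disc Kcvx Kcmp r0_gt0 Kball KM normv2_delta2 sim.
have nt : nontrivial (cline p v `&` K).
  exists (p + z1 *: v), (p + z2 *: v); split; [|split].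
  - by split=> //; exists z1.
  - by split=> //; exists z2.
  - by move=> /(line_param_inj v0) /eqP; rewrite (negbTE z12).
have [a [c [a0 h]]] := Ksim v0 e10 nt (interior_nontrivial e10).
have na := normc2_gt0 a0.
exists ((c0 - c) / a), (rho0 / normc2 a); split; first by rewrite divr_gt0.
move=> z; rewrite h -[K _]/(lsec K p0 e1 _) h0 ler_pdivlMr // -normc2M.
by have -> : (z - (c0 - c) / a) * a = a * z + c - c0 by field.
Qed.

Lemma farthest_point : exists x0, K x0 /\ forall x, K x -> normv2 x <= normv2 x0.
Proof.
have [M hM] := normv2_bounded 0.
have [|x Kx|s [u [hs [Ku lu]]]] := @sup_approx R (Cn R n) K (@normv2 R n) M.
- by exists p0; apply: Kball; rewrite subrr normv2_0.
- by have := hM x Kx; rewrite subr0.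
have [l [Kl ul]] := Kcmp Ku; exists l; split=> // x Kx.
by rewrite (rlim_unique (vlim_normv2 ul) lu); exact: hs.
Qed.

(* The farthest point x0 of K from the origin has a tangent hyperplane that
   meets K in x0 only. *)
Lemma ellipsoid_of_discs : complex_ellipsoid K.
Proof.
have [x0 [Kx0 far]] := farthest_point.
(* The reflection moves x0 to the origin and puts the body on the side Re lam >= 0. *)
pose B : set (Cn R n) := [set y | K (x0 - y)].
pose lam (y : Cn R n) := \sum_i y ord0 i * conjc (x0 ord0 i).
have lamD x y : lam (x + y) = lam x + lam y.
  by rewrite /lam -big_split /=; apply: eq_bigr => i _; rewrite mxE mulrDl.
have lamZ a x : lam (a *: x) = a * lam x.
  by rewrite /lam mulr_sumr; apply: eq_bigr => i _; rewrite mxE mulrA.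
have lamN y : lam (- y) = - lam y by rewrite -scaleN1r lamZ mulN1r.
have NB y : normv2 (x0 - y) = normv2 x0 - 2 * Re (lam y) + normv2 y.
  rewrite /normv2 /lam (big_morph (@complex.Re R) (id1 := 0) (op1 := +%R)) //; last exact: cReD.
  rewrite mulr_sumr -sumrB -big_split /=; apply: eq_bigr => i _.
  by rewrite !mxE /normc2 !cE; ring.
(* |x0 - y|^2 <= |x0|^2 reads |y|^2 <= 2 Re (lam y). *)
have Blam y : B y -> y != 0 -> 0 < Re (lam y).
  by move=> /far; rewrite NB => h /normv2_gt0 y0; lra.
have B0 : B 0 by rewrite /B /= subr0.
have Bcvx : Defs.convex_set B.
  move=> x y t Bx By t01; rewrite /B /=.
  have -> : x0 - (Complex t 0 *: x + (1 - Complex t 0) *: y) =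
    Complex t 0 *: (x0 - x) + (1 - Complex t 0) *: (x0 - y).
    by apply/rowP => i; rewrite !mxE; ring.
  exact: Kcvx.
have Bdisc p v z1 z2 : v != 0 -> z1 != z2 -> B (p + z1 *: v) -> B (p + z2 *: v) ->
  exists c (rho : R), 0 < rho /\ forall z, B (p + z *: v) <-> normc2 (z - c) <= rho.
  have E z : x0 - (p + z *: v) = (x0 - p) + z *: (- v) by rewrite opprD addrA scalerN.
  move=> v0 z12; rewrite /B /= !E => K1 K2.
  have [|c [rho [rho0 h]]] := section_disc _ z12 K1 K2; first by rewrite oppr_eq0.
  by exists c, rho; split=> // z; rewrite E.
have Bball x : normv2 (x - (x0 - p0)) < r0 -> B x.
  move=> h; apply: Kball; have -> : x0 - x - p0 = - (x - (x0 - p0)) by rewrite opprB addrAC.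
  by rewrite normv2N.
(* If x0 were the centre p0 of the ball, one of x0 + t e1 and x0 - t e1 would be farther from the
   origin. *)
have q0 : x0 - p0 != 0.
  rewrite subr_eq0; apply/eqP => E.
  pose t : R := Num.sqrt (r0 / 2).
  have t2 : t ^+ 2 = r0 / 2 by rewrite sqr_sqrtr // divr_ge0 // ltW.
  have nt : normv2 (t%:C%C *: e1) = r0 / 2.
    have := normv2_delta2 t%:C%C 0; rewrite scale0r addr0 => ->.
    by rewrite normc2C t2 normc2_0 addr0.
  have r2 : r0 / 2 < r0 by have := r0_gt0; lra.
  have h1 : K (x0 - t%:C%C *: e1).
    by apply: Kball; rewrite -E addrC addKr normv2N nt.
  have h2 : K (x0 - - (t%:C%C *: e1)).
    by apply: Kball; rewrite -E addrC addKr opprK nt.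
  have := far _ h1; have := far _ h2; rewrite !NB normv2N nt lamN cReN.
  by have := r0_gt0; lra.
have [P [mu [rho [Pu rho0 h]]]] := tangent_ball lamD lamZ Bcvx B0 Bdisc Bball r0_gt0 q0 Blam.
pose s : R := Num.sqrt rho.
have s2 : s ^+ 2 = rho by rewrite sqr_sqrtr // ltW.
have s0 : s%:C%C != 0 :> R[i].
  by apply/eqP => /(congr1 (@complex.Re _)) /= /eqP; rewrite gt_eqF // sqrtr_gt0.
(* Solves (x0 - x) P - mu = s w for x. *)
exists ((- s%:C%C) *: invmx P), (x0 - mu *m invmx P); split.
  by rewrite unitmxZ ?unitmx_inv // unitfE oppr_eq0.
have KE x : K x <-> normv2 ((x0 - x) *m P - mu) <= rho by rewrite -h /B /= subKr.
apply/seteqP; split=> x.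
  move=> /KE; set w := (x0 - x) *m P - mu => hw.
  exists (s%:C%C^-1 *: w).
    rewrite /unit_ball /=; under eq_bigr do rewrite sqr_norm.
    rewrite -rmorph_sum -(rmorph1 (real_complex R)) lecR -/(normv2 _).
    by rewrite normv2Z normc2V normc2C s2 mulrC ler_pdivrMr // mul1r.
  rewrite -scalemxAr -scalemxAl scalerA mulNr mulfV // scaleN1r /w mulmxBl mulmxK //.
  by rewrite opprB addrC addrA subrK opprB addrC subrK.
move=> [w + <-]; rewrite /unit_ball /=; under eq_bigr do rewrite sqr_norm.
rewrite -rmorph_sum -(rmorph1 (real_complex R)) lecR -/(normv2 _) => hw.
apply/KE; have -> : (x0 - (w *m (- s%:C%C *: invmx P) + (x0 - mu *m invmx P))) *m P - mu =
  s%:C%C *: w.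
  rewrite -scalemxAr scaleNr opprD opprK opprB addrCA (addrCA x0) subrr addr0.
  by rewrite mulmxDl -scalemxAl !mulmxKV // addrK.
by rewrite normv2Z normc2C s2 ler_piMr // ltW.
Qed.
End Characterization.

Theorem theorem4p4 (R : realType) (n : nat) (K : set (Cn R n)) :
  (2 <= n)%N -> convex_body K ->
  (complex_ellipsoid K <->
   (forall L1 L2 : set (Cn R n),
      affine_line L1 -> affine_line L2 ->
      nontrivial (L1 `&` K) -> nontrivial (L2 `&` K) ->
      exists phi : Cn R n -> Cn R n,
        affine_bij_on L1 L2 phi /\ phi @` (L1 `&` K) = L2 `&` K)).
Proof.
move=> n2 [Kc Kcvx Kint]; split=> [ell|sim].
  move=> _ _ [p1 [v1 [v10 ->]]] [p2 [v2 [v20 ->]]] nt1 nt2.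
  have [c1 [rho1 [r1 h1]]] := ellipsoid_section_disc ell v10 nt1.
  have [c2 [rho2 [r2 h2]]] := ellipsoid_section_disc ell v20 nt2.
  exact: (discs_equivalent v10 v20 r1 r2 h1 h2).
have [p0 [r0 [r00 Kball]]] := interior_ball Kint.
apply: (ellipsoid_of_discs n2 Kcvx (fun u => compact_vlim Kc) r00 Kball).
move=> p1 v1 p2 v2 v10 v20 nt1 nt2.
have [phi [bij img]] := sim _ _ (cline_affine p1 v10) (cline_affine p2 v20) nt1 nt2.
exact: section_similarity v10 v20 bij img.
Qed.
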